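(* Let $G$ be an arbitrary finite group scheme over a field $k$ of characteristic $p>0$. (1) The trivial $kG$-module $k$ has constant Jordan type. (2) A finite dimensional projective $kG$-module has constant Jordan type. If $kG$ is not semi-simple, then the Jordan type of a projective $kG$-module $P$ is equal to $\frac{\dim_k P}{p}[p]$. (3) For $i\in\mathbb{Z}$, the $i$-th Heller shift $\Omega^i(k)$ of $k$ has constant Jordan type, equal to $n[p]+1[1]$ for some $n\geq 0$ if $i$ is even and equal to $m[p]+1[p-1]$ for some $m\geq 0$ if $i$ is odd. (4) If $M$ has constant Jordan type, then $\Omega^i(M)$ also has constant Jordan type for any $i\in\mathbb{Z}$. (5) If $M,M'$ are $kG$-modules of constant Jordan type, then $M\oplus M'$ also has constant Jordan type.
   Context: $k$ is a field of characteristic $p>0$. A finite group scheme $G$ over $k$ is a group scheme whose coordinate algebra $k[G]$ is finite dimensional; its group algebra $kG$ is the linear dual of $k[G]$. All $kG$-modules are finitely generated. For a field extension $K/k$, $KG=K\otimes_k kG$ is the group algebra of $G_K=G\times_{\mathrm{Spec}\,k}\mathrm{Spec}\,K$, and $M_K=K\otimes_k M$. A $\pi$-point of $G$ is a left flat map of $K$-algebras $\alpha_K:K[t]/t^p\to KG$, for some field extension $K/k$, which factors through the group algebra $KC_K\subset KG$ of some unipotent abelian subgroup scheme $C_K\subset G_K$; $\alpha_K^*$ denotes restriction of modules along $\alpha_K$. Every finite dimensional $K[t]/t^p$-module is a direct sum of $a_i$ copies of the indecomposables $[i]=K[t]/t^i$, $1\le i\le p$; its Jordan type is written $a_p[p]+\cdots+a_1[1]$.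 A finite dimensional $kG$-module $M$ has constant Jordan type if the Jordan type of $\alpha_K^*(M_K)$ is the same for all $\pi$-points $\alpha_K$ of $G$; this common type is the Jordan type of $M$. $\Omega^i(M)$ denotes the $i$-th Heller shift: $\Omega(M)=\Omega^1(M)$ is the kernel of a projective cover of $M$, $\Omega^{-1}(M)$ is the cokernel of an injective hull of $M$, and these are iterated. *)

(* Defs.v *)
From HB Require Import structures.
From mathcomp Require Import all_boot all_order all_algebra.
From mathcomp Require Import qpoly mxtens.

Set Implicit Arguments.
Unset Strict Implicit.
Unset Printing Implicit Defensive.

Import GRing.Theory.
Local Open Scope ring_scope.

(* A finite dimensional space is presented as the column space 'cV_n, its dual
   as the row space 'rV_n, linear maps as matrices acting on columns from the
   left, and tensor products by the Kronecker product *t of mxtens, so that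
   'cV_m (x) 'cV_n = 'cV_(m * n).  The dual of a map is then its action on rows
   from the right, and base change along K/k is [map_mx]. *)

(* e_a (x) e_b |-> e_b (x) e_a *)
Definition swap_index n (i : 'I_(n * n)) : 'I_(n * n) :=
  let: (a, b) := mxtens_unindex i in mxtens_index (b, a).

Definition swap_mx (k : pzRingType) n : 'M[k]_(n * n) :=
  \matrix_(i, j) (i == swap_index j)%:R.

(* e_a (x) e_b (x) e_c (x) e_d |-> e_a (x) e_c (x) e_b (x) e_d *)
Definition midswap_index n (i : 'I_((n * n) * (n * n))) :
    'I_((n * n) * (n * n)) :=
  let: (ab, cd) := mxtens_unindex i in
  let: (a, b) := mxtens_unindex ab in
  let: (c, d) := mxtens_unindex cd in
  mxtens_index (mxtens_index (a, c), mxtens_index (b, d)).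

Definition midswap_mx (k : pzRingType) n : 'M[k]_((n * n) * (n * n)) :=
  \matrix_(i, j) (i == midswap_index j)%:R.

(* A finite group scheme over k is given by its coordinate algebra: a
   commutative Hopf algebra structure on k[G] = 'cV_n (a basis is chosen, which
   loses no generality).  The casts only identify equal products of dimensions. *)
Record finGroupScheme (k : fieldType) := FinGroupScheme {
  gsdim : nat;
  gs_mul : 'M[k]_(gsdim, gsdim * gsdim);
  gs_unit : 'cV[k]_gsdim;
  gs_comul : 'M[k]_(gsdim * gsdim, gsdim);
  gs_counit : 'rV[k]_gsdim;
  gs_antipode : 'M[k]_gsdim;
  gs_mulA : castmx (erefl, esym (mulnA gsdim gsdim gsdim))
              (gs_mul *m (gs_mul *t 1%:M)) = gs_mul *m (1%:M *t gs_mul);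
  gs_mulC : gs_mul *m swap_mx k gsdim = gs_mul;
  gs_mul1 : castmx (erefl, mul1n gsdim) (gs_mul *m (gs_unit *t 1%:M)) = 1%:M;
  gs_comulA : castmx (esym (mulnA gsdim gsdim gsdim), erefl)
                ((gs_comul *t 1%:M) *m gs_comul)
              = (1%:M *t gs_comul) *m gs_comul;
  gs_comul1l : castmx (mul1n gsdim, erefl) ((gs_counit *t 1%:M) *m gs_comul)
               = 1%:M;
  gs_comul1r : castmx (muln1 gsdim, erefl) ((1%:M *t gs_counit) *m gs_comul)
               = 1%:M;
  gs_comulM : gs_comul *m gs_mul =
    (gs_mul *t gs_mul) *m (midswap_mx k gsdim *m (gs_comul *t gs_comul));
  gs_comul_unit : gs_comul *m gs_unit = gs_unit *t gs_unit;
  gs_counitM : gs_counit *m gs_mul = gs_counit *t gs_counit;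
  gs_counit_unit : gs_counit *m gs_unit = 1%:M;
  gs_antipodel : gs_mul *m ((gs_antipode *t 1%:M) *m gs_comul)
                 = gs_unit *m gs_counit;
  gs_antipoder : gs_mul *m ((1%:M *t gs_antipode) *m gs_comul)
                 = gs_unit *m gs_counit
}.

Lemma map_swap_mx (k K : fieldType) (iota : {rmorphism k -> K}) n :
  map_mx iota (swap_mx k n) = swap_mx K n.
Proof. by apply/matrixP => i j; rewrite !mxE rmorph_nat. Qed.

Lemma map_midswap_mx (k K : fieldType) (iota : {rmorphism k -> K}) n :
  map_mx iota (midswap_mx k n) = midswap_mx K n.
Proof. by apply/matrixP => i j; rewrite !mxE rmorph_nat. Qed.

Section BaseChange.
Variables (k K : fieldType) (sigma : {rmorphism k -> K}) (G : finGroupScheme k).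
Local Notation n := (gsdim G).
Local Notation "A ^s" := (map_mx sigma A) (at level 2, format "A ^s").

Let mulA : castmx (erefl, esym (mulnA n n n))
    ((gs_mul G)^s *m ((gs_mul G)^s *t 1%:M))
  = (gs_mul G)^s *m (1%:M *t (gs_mul G)^s).
Proof. by rewrite -(map_mx1 sigma) -!map_mxT -!map_mxM -map_castmx gs_mulA. Qed.

Let mulC : (gs_mul G)^s *m swap_mx K n = (gs_mul G)^s.
Proof. by rewrite -(map_swap_mx sigma) -map_mxM gs_mulC. Qed.

Let mul1 : castmx (erefl, mul1n n) ((gs_mul G)^s *m ((gs_unit G)^s *t 1%:M))
  = 1%:M.
Proof. by rewrite -!(map_mx1 sigma) -!map_mxT -!map_mxM -map_castmx gs_mul1. Qed.

Let comulA : castmx (esym (mulnA n n n), erefl)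
    (((gs_comul G)^s *t 1%:M) *m (gs_comul G)^s)
  = (1%:M *t (gs_comul G)^s) *m (gs_comul G)^s.
Proof.
by rewrite -(map_mx1 sigma) -!map_mxT -!map_mxM -map_castmx gs_comulA.
Qed.

Let comul1l : castmx (mul1n n, erefl)
    (((gs_counit G)^s *t 1%:M) *m (gs_comul G)^s) = 1%:M.
Proof.
by rewrite -!(map_mx1 sigma) -!map_mxT -!map_mxM -map_castmx gs_comul1l.
Qed.

Let comul1r : castmx (muln1 n, erefl)
    ((1%:M *t (gs_counit G)^s) *m (gs_comul G)^s) = 1%:M.
Proof.
by rewrite -!(map_mx1 sigma) -!map_mxT -!map_mxM -map_castmx gs_comul1r.
Qed.

Let comulM : (gs_comul G)^s *m (gs_mul G)^s =
  ((gs_mul G)^s *t (gs_mul G)^s)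
    *m (midswap_mx K n *m ((gs_comul G)^s *t (gs_comul G)^s)).
Proof. by rewrite -(map_midswap_mx sigma) -!map_mxT -!map_mxM gs_comulM. Qed.

Let comul_unit : (gs_comul G)^s *m (gs_unit G)^s
  = (gs_unit G)^s *t (gs_unit G)^s.
Proof. by rewrite -map_mxM gs_comul_unit; exact: (map_mxT sigma (gs_unit G) (gs_unit G)). Qed.

Let counitM : (gs_counit G)^s *m (gs_mul G)^s
  = (gs_counit G)^s *t (gs_counit G)^s.
Proof. by rewrite -map_mxM gs_counitM; exact: (map_mxT sigma (gs_counit G) (gs_counit G)). Qed.

Let counit_unit : (gs_counit G)^s *m (gs_unit G)^s = 1%:M.
Proof. by rewrite -map_mxM gs_counit_unit map_mx1. Qed.

Let antipodel :
  (gs_mul G)^s *m (((gs_antipode G)^s *t 1%:M) *m (gs_comul G)^s)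
  = (gs_unit G)^s *m (gs_counit G)^s.
Proof. by rewrite -(map_mx1 sigma) -!map_mxT -!map_mxM gs_antipodel. Qed.

Let antipoder :
  (gs_mul G)^s *m ((1%:M *t (gs_antipode G)^s) *m (gs_comul G)^s)
  = (gs_unit G)^s *m (gs_counit G)^s.
Proof. by rewrite -(map_mx1 sigma) -!map_mxT -!map_mxM gs_antipoder. Qed.

Definition base_change : finGroupScheme K :=
  FinGroupScheme mulA mulC mul1 comulA comul1l comul1r comulM comul_unit
    counitM counit_unit antipodel antipoder.

End BaseChange.

Section GroupAlgebra.
Variables (k : fieldType) (G : finGroupScheme k).

(* kG is the linear dual of k[G]; its product is dual to the coproduct. *)
Definition group_algebra : Type := 'rV[k]_(gsdim G).

HB.instance Definition _ :=
  GRing.Lmodule.copy group_algebra 'rV[k]_(gsdim G).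

Definition ga_mul (f g : group_algebra) : group_algebra :=
  (f *t g) *m gs_comul G.

Definition ga_one : group_algebra := gs_counit G.

Lemma tensmxA m1 n1 m2 n2 m3 n3 (A : 'M[k]_(m1, n1)) (B : 'M[k]_(m2, n2))
    (C : 'M[k]_(m3, n3)) :
  (A *t B) *t C =
  castmx (mulnA m1 m2 m3, mulnA n1 n2 n3) (A *t (B *t C)).
Proof.
apply/matrixP => i j; rewrite castmxE.
case: (mxtens_indexP i) => ab c; case: (mxtens_indexP ab) => a b.
case: (mxtens_indexP j) => de f; case: (mxtens_indexP de) => d e.
have Hi (x y z : nat) (u : 'I_x) (v : 'I_y) (w : 'I_z) :
    cast_ord (esym (mulnA x y z)) (mxtens_index (mxtens_index (u, v), w))
    = mxtens_index (u, mxtens_index (v, w)).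
  by apply: val_inj; rewrite /= mulnDl -mulnA addnA.
by rewrite !Hi !tensmxE mulrA.
Qed.


Fact ga_mulA : associative ga_mul.
Proof.
move=> f g h; rewrite /ga_mul.
have -> : f *t ((g *t h) *m gs_comul G)
    = (f *t (g *t h)) *m (1%:M *t gs_comul G).
  by rewrite tensmx_mul mulmx1.
have -> : (f *t g *m gs_comul G : 'M_(1 * 1, _)) *t h
    = ((f *t g) *t h) *m (gs_comul G *t 1%:M).
  by rewrite tensmx_mul mulmx1.
rewrite -!mulmxA -gs_comulA tensmxA.
set X := _ *m gs_comul G; set Y := f *t (g *t h).
rewrite mulmx_cast castmx_id; congr (_ *m _).
by apply/matrixP => i j; rewrite !castmxE; congr (Y _ _); apply: val_inj.
Qed.

Let castmx_mul1 m n n' (e : n = n') (A : 'M[k]_(m, n)) (B : 'M[k]_(n', n))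
    (X : 'M[k]_(m, n')) :
  (forall i j, X i j = A i (cast_ord (esym e) j)) ->
  castmx (esym e, erefl) B = 1%:M -> X *m B = A.
Proof.
case: n' / e B X => B X defX; rewrite castmx_id => ->; rewrite mulmx1.
by apply/matrixP => i j; rewrite defX cast_ord_id.
Qed.

Fact ga_mul1l : left_id ga_one ga_mul.
Proof.
move=> f; rewrite /ga_mul /ga_one.
have -> : gs_counit G *t f = (1%:M *t f) *m (gs_counit G *t 1%:M).
  by rewrite tensmx_mul mul1mx mulmx1.
rewrite -mulmxA; apply: (castmx_mul1 (e := esym (mul1n _))); last first.
  by rewrite esymK gs_comul1l.
move=> i j; rewrite tens_scalar1mx castmxE esymK.
by congr (f _ _); apply: val_inj; rewrite ?ord1.
Qed.

Fact ga_mul1r : right_id ga_one ga_mul.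
Proof.
move=> f; rewrite /ga_mul /ga_one.
have -> : f *t gs_counit G = (f *t 1%:M) *m (1%:M *t gs_counit G).
  by rewrite tensmx_mul mul1mx mulmx1.
rewrite -mulmxA; apply: (castmx_mul1 (e := esym (muln1 _))); last first.
  by rewrite esymK gs_comul1r.
move=> i j; rewrite tens_mx_scalar scale1r castmxE esymK.
by congr (f _ _); apply: val_inj; rewrite ?ord1.
Qed.

Let tensmxDl m1 n1 m2 n2 (A B : 'M[k]_(m1, n1)) (C : 'M[k]_(m2, n2)) :
  (A + B) *t C = A *t C + B *t C.
Proof. by apply/matrixP => i j; rewrite !mxE mulrDl. Qed.

Let tensmxDr m1 n1 m2 n2 (A B : 'M[k]_(m1, n1)) (C : 'M[k]_(m2, n2)) :
  C *t (A + B) = C *t A + C *t B.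
Proof. by apply/matrixP => i j; rewrite !mxE mulrDr. Qed.

Let tensmxZl m1 n1 m2 n2 a (A : 'M[k]_(m1, n1)) (C : 'M[k]_(m2, n2)) :
  (a *: A) *t C = a *: (A *t C).
Proof. by apply/matrixP => i j; rewrite !mxE mulrA. Qed.

Let tensmxZr m1 n1 m2 n2 a (A : 'M[k]_(m1, n1)) (C : 'M[k]_(m2, n2)) :
  C *t (a *: A) = a *: (C *t A).
Proof. by apply/matrixP => i j; rewrite !mxE mulrCA. Qed.

Fact ga_mulDl : left_distributive ga_mul +%R.
Proof. by move=> f g h; rewrite /ga_mul tensmxDl mulmxDl. Qed.

Fact ga_mulDr : right_distributive ga_mul +%R.
Proof. by move=> f g h; rewrite /ga_mul tensmxDr mulmxDl. Qed.

Fact ga_one_neq0 : ga_one != 0.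
Proof.
apply/eqP => /(congr1 (fun f : 'rV_(gsdim G) => (f *m gs_unit G) 0 0)).
rewrite /ga_one gs_counit_unit mul0mx !mxE => /eqP.
by rewrite oner_eq0.
Qed.

HB.instance Definition _ := GRing.Zmodule_isNzRing.Build group_algebra
  ga_mulA ga_mul1l ga_mul1r ga_mulDl ga_mulDr ga_one_neq0.

Fact ga_scaleAl (a : k) (f g : group_algebra) : a *: (f * g) = (a *: f) * g.
Proof. by rewrite /GRing.mul /= /ga_mul tensmxZl -scalemxAl. Qed.

HB.instance Definition _ := GRing.Lmodule_isLalgebra.Build k group_algebra
  ga_scaleAl.

Fact ga_scaleAr (a : k) (f g : group_algebra) : a *: (f * g) = f * (a *: g).
Proof. by rewrite /GRing.mul /= /ga_mul tensmxZr -scalemxAl. Qed.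

HB.instance Definition _ := GRing.Lalgebra_isAlgebra.Build k group_algebra
  ga_scaleAr.

End GroupAlgebra.

(* The counit of kG: evaluation of a functional at 1 in k[G]. *)
Definition augmentation (k : fieldType) (G : finGroupScheme k)
    (x : group_algebra G) : k := ((x : 'rV_(gsdim G)) *m gs_unit G) 0 0.

(* Finite dimensional left A-modules, with underlying space 'cV_(mdim M). *)
Record fdmod (k : fieldType) (A : algType k) := FdMod {
  mdim : nat;
  mact : {linear A -> 'M[k]_mdim};
  mact1 : mact 1 = 1%:M;
  mactM : forall a b, mact (a * b) = mact a *m mact b
}.

Section Modules.
Variables (k : fieldType) (A : algType k).
Implicit Types M N P I : fdmod A.

Definition is_hom M N (f : 'M[k]_(mdim N, mdim M)) : Prop :=
  forall a, f *m mact M a = mact N a *m f.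

Definition mono m n (f : 'M[k]_(n, m)) : Prop :=
  forall v : 'cV[k]_m, f *m v = 0 -> v = 0.

Definition epi m n (f : 'M[k]_(n, m)) : Prop :=
  forall w : 'cV[k]_n, exists v : 'cV[k]_m, f *m v = w.

Definition mod_iso M N : Prop :=
  exists (f : 'M_(mdim N, mdim M)) (g : 'M_(mdim M, mdim N)),
    [/\ is_hom f, is_hom g, f *m g = 1%:M & g *m f = 1%:M].

Definition short_exact L M N (f : 'M_(mdim M, mdim L))
    (g : 'M_(mdim N, mdim M)) : Prop :=
  [/\ is_hom f, is_hom g, mono f, epi g &
      forall v : 'cV_(mdim M), g *m v = 0 <-> exists u, v = f *m u].

Definition projective P : Prop :=
  forall M N (g : 'M_(mdim N, mdim M)) (f : 'M_(mdim N, mdim P)),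
    is_hom g -> epi g -> is_hom f ->
    exists2 h : 'M_(mdim M, mdim P), is_hom h & g *m h = f.

Definition injective I : Prop :=
  forall M N (g : 'M_(mdim N, mdim M)) (f : 'M_(mdim I, mdim M)),
    is_hom g -> mono g -> is_hom f ->
    exists2 h : 'M_(mdim I, mdim N), is_hom h & h *m g = f.

Definition projective_cover P M (q : 'M_(mdim M, mdim P)) : Prop :=
  [/\ projective P, is_hom q, epi q &
      forall N (h : 'M_(mdim P, mdim N)), is_hom h -> epi (q *m h) -> epi h].

Definition injective_hull M I (j : 'M_(mdim I, mdim M)) : Prop :=
  [/\ injective I, is_hom j, mono j &
      forall N (h : 'M_(mdim N, mdim I)), is_hom h -> mono (h *m j) -> mono h].

Definition is_Omega M L : Prop :=
  exists P (i : 'M_(mdim P, mdim L)) (q : 'M_(mdim M, mdim P)),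
    projective_cover q /\ short_exact i q.

Definition is_Omega_inv M L : Prop :=
  exists I (j : 'M_(mdim I, mdim M)) (q : 'M_(mdim L, mdim I)),
    injective_hull j /\ short_exact j q.

Fixpoint iter_rel (R : fdmod A -> fdmod A -> Prop) (n : nat) M L : Prop :=
  if n is n'.+1 then exists2 N, iter_rel R n' M N & R N L else mod_iso M L.

(* L is (a representative of the isomorphism class) Omega^i(M). *)
Definition is_Heller_shift (i : int) M L : Prop :=
  match i with
  | Posz n => iter_rel is_Omega n M L
  | Negz n => iter_rel is_Omega_inv n.+1 M L
  end.

(* Submodules of modules are direct summands. *)
Definition semisimple : Prop :=
  forall M N (f : 'M_(mdim N, mdim M)), is_hom f -> mono f ->
    exists2 r : 'M_(mdim M, mdim N), is_hom r & r *m f = 1%:M.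

Definition zero_act (a : A) : 'M[k]_0 := 0.
Fact zero_act_is_linear : linear zero_act.
Proof. by move=> c a b; rewrite /zero_act scaler0 addr0. Qed.
HB.instance Definition _ :=
  GRing.isLinear.Build k A 'M[k]_0 _ zero_act zero_act_is_linear.

Fact zero_act1 : zero_act 1 = 1%:M.
Proof. by apply/matrixP => -[]. Qed.
Fact zero_actM a b : zero_act (a * b) = zero_act a *m zero_act b.
Proof. by rewrite /zero_act mul0mx. Qed.

Definition zero_mod : fdmod A := FdMod zero_act1 zero_actM.

Section DirectSum.
Variables M N : fdmod A.

Definition dsum_act (a : A) : 'M[k]_(mdim M + mdim N) :=
  block_mx (mact M a) 0 0 (mact N a).
Fact dsum_act_is_linear : linear dsum_act.
Proof.
move=> c a b; rewrite /dsum_act scale_block_mx add_block_mx !linearP.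
by rewrite !scaler0 !addr0.
Qed.
HB.instance Definition _ :=
  GRing.isLinear.Build k A 'M[k]_(mdim M + mdim N) _ dsum_act
    dsum_act_is_linear.

Fact dsum_act1 : dsum_act 1 = 1%:M.
Proof. by rewrite /dsum_act !mact1 -scalar_mx_block. Qed.
Fact dsum_actM a b : dsum_act (a * b) = dsum_act a *m dsum_act b.
Proof.
by rewrite /dsum_act !mactM mulmx_block !mulmx0 !mul0mx !addr0 !add0r.
Qed.

Definition dsum : fdmod A := FdMod dsum_act1 dsum_actM.

End DirectSum.

End Modules.

Section Restriction.
Variables (k : fieldType) (A B : algType k) (alpha : {lrmorphism A -> B}).
Variable M : fdmod B.

Definition restr_act : A -> 'M[k]_(mdim M) := mact M \o alpha.
HB.instance Definition _ := GRing.Linear.on restr_act.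

Fact restr_act1 : restr_act 1 = 1%:M.
Proof. by rewrite /restr_act /= rmorph1 mact1. Qed.
Fact restr_actM a b : restr_act (a * b) = restr_act a *m restr_act b.
Proof. by rewrite /restr_act /= rmorphM mactM. Qed.

Definition restriction : fdmod A := FdMod restr_act1 restr_actM.

End Restriction.

Section Flatness.
Variables (k : fieldType) (A : comAlgType k).

(* X (x)_A M is the quotient of X (x)_k M by this subspace; A being
   commutative, no distinction is made between left and right modules. *)
Definition balancing (X M : fdmod A) (w : 'cV[k]_(mdim X * mdim M)) : Prop :=
  exists s : seq ('cV[k]_(mdim X) * A * 'cV[k]_(mdim M)),
    w = \sum_(t <- s) ((mact X t.1.2 *m t.1.1) *t t.2
                       - t.1.1 *t (mact M t.1.2 *m t.2)).

(* (- (x)_A M) preserves injections. *)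
Definition flat (M : fdmod A) : Prop :=
  forall (X Y : fdmod A) (f : 'M[k]_(mdim Y, mdim X)), is_hom f -> mono f ->
  forall w : 'cV[k]_(mdim X * mdim M),
    @balancing Y M ((f *t 1%:M) *m w) -> balancing w.

End Flatness.

Section GroupModules.
Variables (k : fieldType) (G : finGroupScheme k).
Local Notation n := (gsdim G).
Local Notation kG := (group_algebra G).

Definition triv_act (x : kG) : 'M[k]_1 := (x : 'rV_n) *m gs_unit G.
Fact triv_act_is_linear : linear triv_act.
Proof. by move=> c x y; rewrite /triv_act mulmxDl -scalemxAl. Qed.
HB.instance Definition _ :=
  GRing.isLinear.Build k kG 'M[k]_1 _ triv_act triv_act_is_linear.

Fact triv_act1 : triv_act 1 = 1%:M.
Proof. exact: gs_counit_unit. Qed.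
Fact triv_actM x y : triv_act (x * y) = triv_act x *m triv_act y.
Proof.
transitivity ((x *t y) *m (gs_comul G *m gs_unit G)).
  exact: (esym (mulmxA (x *t y) _ _)).
rewrite gs_comul_unit.
have -> : (x *t y) *m (gs_unit G *t gs_unit G)
    = ((x : 'rV_n) *m gs_unit G) *t ((y : 'rV_n) *m gs_unit G).
  exact: tensmx_mul.
by apply/matrixP => i j; rewrite [LHS]mxE [RHS]mxE big_ord1 !ord1.
Qed.

Definition trivial_mod : fdmod kG := FdMod triv_act1 triv_actM.

Definition ga_basis (i : 'I_n) : kG := delta_mx 0 i.

Fact ga_basisE (x : kG) : x = \sum_i (x : 'rV_n) 0 i *: ga_basis i.
Proof. exact: row_sum_delta. Qed.

(* v : 'cV_n stands for the element v^T of kG. *)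
Definition reg_act (x : kG) : 'M[k]_n :=
  \matrix_(i, j) (x * ga_basis j : 'rV_n) 0 i.
Let reg_actE x i j : reg_act x i j = (x * ga_basis j : 'rV_n) 0 i.
Proof. exact: mxE. Qed.

Let ga_addE (x y : kG) i :
  ((x + y : kG) : 'rV_n) 0 i = (x : 'rV_n) 0 i + (y : 'rV_n) 0 i.
Proof. exact: mxE. Qed.

Let ga_scaleE c (x : kG) i :
  ((c *: x : kG) : 'rV_n) 0 i = c * (x : 'rV_n) 0 i.
Proof. exact: mxE. Qed.

Let ga_sumE (I : Type) (s : seq I) (F : I -> kG) i :
  ((\sum_(l <- s) F l : kG) : 'rV_n) 0 i = \sum_(l <- s) (F l : 'rV_n) 0 i.
Proof. exact: summxE. Qed.

Fact reg_act_is_linear : linear reg_act.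
Proof.
move=> c x y; apply/matrixP => i j; rewrite [RHS]mxE [X in _ = X + _]mxE.
by rewrite !reg_actE mulrDl -scalerAl ga_addE ga_scaleE.
Qed.
HB.instance Definition _ :=
  GRing.isLinear.Build k kG 'M[k]_n _ reg_act reg_act_is_linear.

Fact reg_act1 : reg_act 1 = 1%:M.
Proof.
apply/matrixP => i j; rewrite reg_actE mul1r /ga_basis !mxE eqxx /=.
by rewrite eq_sym.
Qed.
Fact reg_actM x y : reg_act (x * y) = reg_act x *m reg_act y.
Proof.
apply/matrixP => i j; rewrite reg_actE -mulrA (ga_basisE (y * _)).
rewrite mulr_sumr ga_sumE [RHS]mxE; apply: eq_bigr => l _.
by rewrite -scalerAr ga_scaleE !reg_actE mulrC.
Qed.

Definition regular_mod : fdmod kG := FdMod reg_act1 reg_actM.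

Section ModuleBaseChange.
Variables (K : fieldType) (sigma : {rmorphism k -> K}) (M : fdmod kG).
Local Notation KG := (group_algebra (base_change sigma G)).

(* The K-linear extension of the action of kG, as KG = K (x)_k kG. *)
Definition bc_act (x : KG) : 'M[K]_(mdim M) :=
  \sum_(i < n) (x : 'rV[K]_n) 0 i *: map_mx sigma (mact M (ga_basis i)).
Fact bc_act_is_linear : linear bc_act.
Proof.
move=> c x y; rewrite /bc_act scaler_sumr -big_split; apply: eq_bigr => i _.
by rewrite !mxE scalerDl scalerA.
Qed.
HB.instance Definition _ :=
  GRing.isLinear.Build K KG 'M[K]_(mdim M) _ bc_act bc_act_is_linear.

Let bc_act_map (x : kG) :
  bc_act (map_mx sigma (x : 'rV_n)) = map_mx sigma (mact M x).
Proof.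
rewrite {2}(ga_basisE x) linear_sum map_mx_sum; apply: eq_bigr => i _.
by rewrite linearZ map_mxZ mxE.
Qed.

Fact bc_act1 : bc_act 1 = 1%:M.
Proof. by rewrite (bc_act_map 1) mact1 map_mx1. Qed.

Let bc_mul_map (x y : kG) :
  (map_mx sigma (x : 'rV_n) : KG) * (map_mx sigma (y : 'rV_n) : KG)
  = map_mx sigma (x * y : 'rV_n).
Proof.
rewrite /GRing.mul /= /ga_mul /= map_mxM; congr (_ *m _).
by rewrite -map_mxT.
Qed.

Fact bc_actM x y : bc_act (x * y) = bc_act x *m bc_act y.
Proof.
have E (z : KG) : z = \sum_(i < n) (z : 'rV_n) 0 i *:
    (map_mx sigma (ga_basis i : 'rV_n) : KG).
  rewrite {1}[z](row_sum_delta (z : 'rV[K]_n)); apply: eq_bigr => i _.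
  by rewrite map_delta_mx.
rewrite {1}(E x) {1}(E y) mulr_suml [RHS]mulmx_suml linear_sum.
apply: eq_bigr => i _; rewrite mulr_sumr mulmx_sumr linear_sum.
apply: eq_bigr => j _; rewrite -scalerAl -scalerAr !linearZ /=.
by rewrite bc_mul_map bc_act_map mactM map_mxM -scalemxAl !scalerA mulrC.
Qed.

Definition base_change_mod : fdmod KG := FdMod bc_act1 bc_actM.

End ModuleBaseChange.

(* phi : k[G] -> k[C] is the comorphism of a closed immersion of group schemes
   C -> G; the induced map kC -> kG is x |-> x *m phi. *)
Definition closed_subgroup (C : finGroupScheme k)
    (phi : 'M[k]_(gsdim C, gsdim G)) : Prop :=
  [/\ phi *m gs_mul G = gs_mul C *m (phi *t phi),
      phi *m gs_unit G = gs_unit C,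
      gs_comul C *m phi = (phi *t phi) *m gs_comul G,
      gs_counit C *m phi = gs_counit G &
      epi phi].

Definition abelian_gs : Prop := swap_mx k n *m gs_comul G = gs_comul G.

Definition unipotent_gs : Prop :=
  forall M : fdmod kG, (0 < mdim M)%N ->
  exists2 v : 'cV_(mdim M), v != 0 &
    forall x, mact M x *m v = augmentation x *: v.

End GroupModules.

Definition trunc_poly (K : fieldType) (p : nat) : comAlgType K :=
  {poly %/ ('X^p : {poly K})}.

Record pi_point (p : nat) (k : fieldType) (G : finGroupScheme k) := PiPoint {
  pp_field : fieldType;
  pp_ext : {rmorphism k -> pp_field};
  pp_map : {lrmorphism trunc_poly pp_field p ->
              group_algebra (base_change pp_ext G)};
  pp_flat : flat (restriction pp_map (regular_mod (base_change pp_ext G)));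
  pp_factor :
    exists (C : finGroupScheme pp_field)
           (phi : 'M[pp_field]_(gsdim C, gsdim (base_change pp_ext G)))
           (beta : {lrmorphism trunc_poly pp_field p -> group_algebra C}),
      [/\ closed_subgroup phi, abelian_gs C, unipotent_gs C &
          forall q, pp_map q = (beta q : 'rV_(gsdim C)) *m phi]
}.

Section JordanType.
Variables (K : fieldType) (p : nat).
Local Notation R := (trunc_poly K p).

Section Block.
Variable i : 'I_p.

(* Multiplication by q on K[t]/t^(i+1), in the basis 1, t, ..., t^i. *)
Definition jblock_act (q : R) : 'M[K]_i.+1 :=
  \matrix_(r, c) if (c <= r)%N then (q : {poly K})`_(r - c) else 0.
Fact jblock_act_is_linear : linear jblock_act.
Proof.
move=> a q1 q2; apply/matrixP => r c; rewrite !mxE.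
by case: ifP => _; rewrite ?mulr0 ?addr0 //= coefD coefZ.
Qed.
HB.instance Definition _ :=
  GRing.isLinear.Build K R 'M[K]_i.+1 _ jblock_act jblock_act_is_linear.

Fact jblock_act1 : jblock_act 1 = 1%:M.
Proof.
apply/matrixP => r c; rewrite !mxE /= coefC subn_eq0 -val_eqE /=.
by case: ltngtP.
Qed.
Fact jblock_actM q1 q2 :
  jblock_act (q1 * q2) = jblock_act q1 *m jblock_act q2.
Proof.
have p_gt0 : (0 < p)%N by case: (p) i => [[]|].
apply/matrixP => r c; rewrite !mxE.
pose F s := (if (s <= r)%N then (q1 : {poly K})`_(r - s) else 0) *
  (if (c <= s)%N then (q2 : {poly K})`_(s - c) else 0).
have -> : \sum_s jblock_act q1 r s * jblock_act q2 s c = \sum_(0 <= s < i.+1) F s.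
  by rewrite big_mkord; apply: eq_bigr => s _; rewrite !mxE.
rewrite (@big_cat_nat _ _ _ c) ?(ltnW (ltn_ord c)) //=.
rewrite [X in X + _]big_nat [X in X + _]big1 ?add0r; last first.
  by move=> s /= lt_sc; rewrite /F [X in _ * X]ifF ?mulr0 // leqNgt lt_sc.
case: leqP => [le_cr | lt_rc]; last first.
  rewrite big_nat big1 // => s /andP[le_cs _].
  by rewrite /F ifF ?mul0r // leqNgt (leq_trans lt_rc).
rewrite (@big_cat_nat _ _ _ r.+1) //= ?(leqW le_cr) //.
rewrite [X in _ + X]big_nat [X in _ + X]big1 ?addr0; last first.
  by move=> s /andP[lt_rs _]; rewrite /F ifF ?mul0r // leqNgt lt_rs.
have lt_p : (r - c < p)%N.
  by rewrite (leq_ltn_trans (leq_subr _ _)) // (leq_trans (ltn_ord r)).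
have -> : ((q1 * q2 : R) : {poly K})`_(r - c)
    = ((q1 : {poly K}) * (q2 : {poly K}))`_(r - c).
  have coefR (f : {poly K}) :
      (Pdiv.CommonRing.rmodp f (mk_monic 'X^p))`_(r - c) = f`_(r - c).
    rewrite mk_monic_Xn prednK // -Pdiv.RingMonic.take_poly_rmodp.
    by rewrite coef_take_poly lt_p.
  exact: coefR.
have -> : \sum_(c <= s < r.+1) F s = \sum_(0 <= j < (r - c).+1) F (j + c)%N.
  by rewrite -{1}[c : nat]add0n big_addn subSn.
rewrite coefMr big_mkord.
apply: eq_bigr => j _; rewrite /F addnK leq_addl.
have lej : (j + c <= r)%N by rewrite addnC -leq_subRL // -ltnS.
by rewrite lej addnC subnDA.
Qed.

Definition jblock : fdmod R := FdMod jblock_act1 jblock_actM.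

End Block.

(* The type a_p[p] + ... + a_1[1] is the function i |-> a_(i+1). *)
Definition jordan_mod (a : {ffun 'I_p -> nat}) : fdmod R :=
  \big[@dsum K R/zero_mod R]_(i < p) iter (a i) (dsum (jblock i)) (zero_mod R).

Definition has_jordan_type (M : fdmod R) (a : {ffun 'I_p -> nat}) : Prop :=
  mod_iso M (jordan_mod a).

End JordanType.

(* The formal sum 1[j]. *)
Definition jt (p j : nat) : {ffun 'I_p -> nat} :=
  [ffun i : 'I_p => nat_of_bool (i.+1 == j)].

Section ConstantJordanType.
Variables (p : nat) (k : fieldType) (G : finGroupScheme k).
Implicit Type M : fdmod (group_algebra G).

(* Over all pi-points, whatever the extension field, the type is a. *)
Definition has_constant_jordan_type M (a : {ffun 'I_p -> nat}) : Prop :=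
  forall alpha : pi_point p G,
    has_jordan_type (restriction (pp_map alpha)
                       (base_change_mod (pp_ext alpha) M)) a.

Definition constant_jordan_type M : Prop :=
  exists a, has_constant_jordan_type M a.

End ConstantJordanType.

(* Main.v *)
Require Import Defs.
From HB Require Import structures.
From mathcomp Require Import all_boot all_order all_algebra.
From mathcomp Require Import qpoly mxtens zify ring.
Import GRing.Theory.
Local Open Scope ring_scope.
Set Implicit Arguments.
Unset Strict Implicit.
Unset Printing Implicit Defensive.

(** Restricting a module along a pi-point gives a K[t]/t^p-module, that is, a
    square matrix X with X^p = 0, and its Jordan type is equivalent to the
    sequence of the ranks of the X^j ([jordan_typeP]).  A module therefore has
    constant Jordan type exactly when these ranks, [pi_rank], do not depend on
    the pi-point, and every claim of the theorem becomes a computation of ranks.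

    The main point is that projective modules become free along every pi-point.
    Splitting the surjection from kG (x) P onto P describes projectivity by
    finitely many elements sigma_ij of kG satisfying two equations ([casimir]);
    such equations survive the extension from k to K.  Flatness of a pi-point
    says that ker X^(p-1) lies in im X for X acting on KG, and the equations
    carry this over to P ([casimir_nilfree]).  All ranks on P_K are then
    (p - j) dim P / p.

    If L -> P -> N is exact and P is free along the pi-point, the image of X^j
    on L can be computed from the kernel of X^(p-j) on N, which gives
        rk_L X^j + dim N = rk_N X^(p-j) + (p - j) dim P / p
    ([exact_rank_shift]).  The relation determines each of the two rank
    sequences from the other, so it serves both Omega and its inverse.  A module
    of stable type [q] goes to one of stable type [p - q], whence the
    alternation between [1] and [p-1] in the shifts of k.

    For the inverse of Omega one needs that injective modules are projective.
    An injective module I satisfies the equations dual to those above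
    ([cocasimir]).  In the category of modules I is a direct summand of
    I (x) I^* (x) I, and I^* is projective by duality; writing out the resulting
    splitting gives explicit elements sigma_ij in terms of the dual ones
    ([transfer]), and [cocasimir_casimir] checks the equations for them.

    Divisibility of dim P by p when kG is not semisimple cannot be read off from
    a pi-point, as none is given.  Instead, if dim P is nonzero in k, the trace
    on P turns the sigma_ij into a left integral of kG whose augmentation is
    dim P, and averaging with it splits every injection ([maschke]).

    Identities in the Hopf algebra are verified at the generic point of G: a
    module is encoded by an invertible matrix [gpt] over the commutative ring
    k[G], and the coproduct sends it to the product of two copies of it over
    k[G] (x) k[G].  The antipode supplies the inverse matrix, so that these
    verifications become manipulations of matrices over a commutative ring. *)

(** * Nilpotent matrices that are free over K[t]/t^p *)

Section KernelImage.
Variable K : fieldType.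

Definition exact_at m n l (Z : 'M[K]_(m, n)) (Y : 'M[K]_(l, m)) : Prop :=
  forall v : 'cV_m, Y *m v = 0 <-> exists w, v = Z *m w.

Lemma exact_kermx m n l (Z : 'M[K]_(m, n)) (Y : 'M[K]_(l, m)) :
  exact_at Z Y -> (kermx Y^T :=: Z^T)%MS.
Proof.
move=> ex; apply/eqmxP/andP; split; last first.
  apply/sub_kermxP/trmx_inj; rewrite trmx_mul !trmxK trmx0.
  apply/matrixP => i j; have /(_ (Z *m delta_mx j 0)) [_] := ex.
  move=> /(_ (ex_intro _ _ erefl)) /matrixP /(_ i 0).
  by rewrite mulmxA -colE !mxE.
apply/row_subP => i.
have /ex [w Ew] : Y *m (row i (kermx Y^T))^T = 0.
  by apply: trmx_inj; rewrite trmx_mul trmxK -row_mul mulmx_ker trmx0 row0.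
by apply/submxP; exists w^T; rewrite -trmx_mul -Ew trmxK.
Qed.

Lemma exact_rank m n l (Z : 'M[K]_(m, n)) (Y : 'M[K]_(l, m)) :
  exact_at Z Y -> (\rank Z + \rank Y)%N = m.
Proof.
move=> /exact_kermx ex; rewrite -(mxrank_tr Z) -ex mxrank_ker mxrank_tr.
by rewrite subnK // rank_leq_col.
Qed.

Lemma rank_exactP m n l (Z : 'M[K]_(m, n)) (Y : 'M[K]_(l, m)) :
  Y *m Z = 0 -> (\rank Z + \rank Y)%N = m -> exact_at Z Y.
Proof.
move=> YZ rk v; split=> [Yv|[w ->]]; last by rewrite mulmxA YZ mul0mx.
have le : (Z^T <= kermx Y^T)%MS.
  by apply/sub_kermxP; rewrite -trmx_mul YZ trmx0.
have /eqmxP E : (Z^T == kermx Y^T)%MS.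
  by rewrite -(mxrank_leqif_eq le) mxrank_ker !mxrank_tr; lia.
have : (v^T <= Z^T)%MS by rewrite E; apply/sub_kermxP; rewrite -trmx_mul Yv trmx0.
by case/submxP => D /(congr1 trmx); rewrite trmx_mul !trmxK => ->; exists D^T.
Qed.

Lemma mxXS m (X : 'M[K]_m) j : X ^+ j.+1 = X *m X ^+ j.
Proof. exact: exprS. Qed.

Lemma mxXSr m (X : 'M[K]_m) j : X ^+ j.+1 = X ^+ j *m X.
Proof. exact: exprSr. Qed.

Lemma mxXD m (X : 'M[K]_m) i j : X ^+ (i + j) = X ^+ i *m X ^+ j.
Proof. exact: exprD. Qed.

Lemma intertwineX m n (X : 'M[K]_m) (Y : 'M[K]_n) (f : 'M_(n, m)) j :
  f *m X = Y *m f -> f *m X ^+ j = Y ^+ j *m f.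
Proof.
move=> E; elim: j => [|j IH]; first by rewrite mulmx1 mul1mx.
by rewrite mxXS mulmxA E -mulmxA IH mulmxA -mxXS.
Qed.

Section Nilfree.
Variables (p m : nat) (X : 'M[K]_m).

(** Freeness of the K[t]/t^p-module defined by X, in the form in which flatness
    delivers it: tensoring with the inclusion of the socle K of K[t]/t^p preserves
    injectivity. *)
Definition nilfree : Prop :=
  X ^+ p = 0 /\ forall v : 'cV_m, X ^+ p.-1 *m v = 0 -> exists w, v = X *m w.

Hypothesis Xfree : nilfree.

(** Downward induction on j: a vector killed by X^j is killed by X^(p-1), hence
    is some X w, and then X^(j+1) w = 0. *)
Lemma nilfree_exact j : (j <= p)%N -> exact_at (X ^+ (p - j)) (X ^+ j).
Proof.
case: Xfree => Xp Xker; move=> le_jp; move E : (p - j)%N => i.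
elim: i j le_jp E => [|i IH] j le_jp E v; split.
- by exists v; rewrite mul1mx.
- by have -> : j = p by [lia]; rewrite Xp mul0mx.
- move=> Xv; have [|w Ew] := Xker v.
    have -> : p.-1 = (p.-1 - j + j)%N by lia.
    by rewrite mxXD -mulmxA Xv mulmx0.
  have : X ^+ j.+1 *m w = 0 by rewrite mxXSr -mulmxA -Ew.
  rewrite (IH j.+1); [case=> u Eu | lia | lia].
  by exists u; rewrite Ew Eu mulmxA -mxXS.
- case=> w ->; rewrite mulmxA -mxXD.
  by rewrite (_ : (j + i.+1)%N = p) ?Xp ?mul0mx //; lia.
Qed.

Lemma nilfree_rank_compl j : (j <= p)%N ->
  (\rank (X ^+ j) + \rank (X ^+ (p - j)))%N = m.
Proof. by move=> lejp; rewrite addnC; apply/exact_rank/nilfree_exact. Qed.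

Lemma nilfree_rank j : (0 < p)%N -> (j <= p)%N ->
  (p %| m)%N /\ \rank (X ^+ j) = ((p - j) * (m %/ p))%N.
Proof.
move=> p_gt0.
pose r := \rank (X ^+ p.-1).
(* each step down loses ker X, which lies in every im X^j with j < p *)
have step i : (i < p)%N -> \rank (X ^+ i) = (\rank (X ^+ i.+1) + r)%N.
  move=> lt_ip; rewrite -(mxrank_tr (X ^+ i)) -(mxrank_mul_ker _ X^T).
  rewrite -trmx_mul -mxXS mxrank_tr; congr (_ + _)%N.
  have E : (kermx X^T :=: (X ^+ p.-1)^T)%MS.
    by have := exact_kermx (nilfree_exact p_gt0); rewrite expr1 subn1.
  rewrite (cap_eqmx (eqmx_refl _) E) /r -[RHS]mxrank_tr.
  apply: eqmx_rank; apply/eqmxP; apply: capmx_idPr.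
  by rewrite (_ : p.-1 = i + (p.-1 - i))%N ?mxXD ?trmx_mul ?submxMl //; lia.
have rkE i : (i <= p)%N -> \rank (X ^+ (p - i)) = (i * r)%N.
  elim: i => [|i IH] le_ip; first by rewrite subn0 Xfree.1 mxrank0.
  rewrite step; [rewrite mulSn addnC -IH | lia]; last lia.
  by congr (_ + \rank (X ^+ _))%N; lia.
have mE : m = (p * r)%N by rewrite -(rkE p) // subnn mxrank1.
move=> lejp; rewrite [in (p %| m)%N]mE dvdn_mulr //; split=> //.
by rewrite [in (m %/ p)%N]mE mulKn // -rkE; [congr (\rank (X ^+ _)); lia | lia].
Qed.

End Nilfree.

(** X_N^j has the rank of X_P^j on im f = ker g.  Its kernel there is the
    intersection of ker g with ker X_P^j = im X_P^(p-j), which has dimension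
    rk X_P^(p-j) - rk X_M^(p-j) because g maps im X_P^(p-j) onto im X_M^(p-j). *)
Lemma exact_rank_shift p mN mP mM (XN : 'M[K]_mN) (XP : 'M[K]_mP) (XM : 'M[K]_mM)
    (f : 'M_(mP, mN)) (g : 'M_(mM, mP)) j :
  \rank f = mN -> \rank g = mM -> exact_at f g ->
  f *m XN = XP *m f -> g *m XP = XM *m g -> nilfree p XP -> (j <= p)%N ->
  (\rank (XN ^+ j) + mM = \rank (XM ^+ (p - j)) + \rank (XP ^+ j))%N.
Proof.
move=> rkf rkg ex fX gX XPfree le_jp.
have ker_g := exact_kermx ex.
have rkN : \rank (XN ^+ j) = \rank (XP ^+ j *m f).
  rewrite -(intertwineX _ fX) -mxrank_tr -[RHS]mxrank_tr trmx_mul mxrankMfree //.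
  by rewrite -row_leq_rank mxrank_tr rkf.
have rkM : \rank (XM ^+ (p - j)) = \rank (g *m XP ^+ (p - j)).
  rewrite (intertwineX _ gX) mxrankMfree //.
  by rewrite -row_leq_rank rkg.
have := mxrank_mul_ker f^T (XP ^+ j)^T.
have E := exact_kermx (nilfree_exact XPfree le_jp).
rewrite -trmx_mul !mxrank_tr -rkN (cap_eqmx (eqmx_refl _) E) rkf.
have := mxrank_mul_ker (XP ^+ (p - j))^T g^T.
rewrite -trmx_mul !mxrank_tr -rkM (cap_eqmx (eqmx_refl _) ker_g).
rewrite capmxC => e1 e2.
have := nilfree_rank_compl XPfree le_jp.
have := exact_rank ex; rewrite rkf rkg; move: e1 e2.
move: (\rank (f^T :&: _)) (\rank (XN ^+ j)) (\rank (XM ^+ _)).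
by move: (\rank (XP ^+ j)) (\rank (XP ^+ (p - j))) => *; lia.
Qed.

End KernelImage.

(** * Modules over K[t]/t^p and direct sums *)

Lemma mactX (k : fieldType) (A : algType k) (M : fdmod A) a j :
  mact M (a ^+ j) = mact M a ^+ j.
Proof.
by elim: j => [|j IH]; [exact: mact1 | rewrite exprS mactM IH mxXS].
Qed.

Section Trunc.
Variables (K : fieldType) (p : nat).
Local Notation R := (trunc_poly K p).

Definition tvar : R := in_qpoly 'X^p 'X.

Lemma tvarXE j : tvar ^+ j = in_qpoly 'X^p 'X^j.
Proof. by rewrite /tvar -(rmorphXn (in_qpoly ('X^p : {poly K}))). Qed.

Lemma trunc_sum (a : R) :
  a = \sum_(i < size (a : {poly K})) (a : {poly K})`_i *: tvar ^+ i.
Proof.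
have {1}-> : a = in_qpoly 'X^p (a : {poly K}).
  by apply/val_inj/esym/in_qpoly_small/size_mk_monic.
rewrite -{1}[a : {poly K}]coefK poly_def linear_sum; apply: eq_bigr => i _.
by rewrite linearZ tvarXE.
Qed.

Hypothesis p_gt0 : (0 < p)%N.

Lemma mk_monicXp : mk_monic ('X^p : {poly K}) = 'X^p.
Proof. by rewrite mk_monic_Xn prednK. Qed.

Lemma tvar_nilp : tvar ^+ p = 0.
Proof.
rewrite tvarXE; apply: val_inj; rewrite /= mk_monicXp.
by rewrite Pdiv.CommonRing.rmodpp // /GRing.comm lead_coefXn mulr1 mul1r.
Qed.

Lemma coef_tvarX j c : (j < p)%N -> (tvar ^+ j : {poly K})`_c = (c == j)%:R.
Proof.
by move=> lt_jp; rewrite tvarXE in_qpoly_small ?coefXn // mk_monicXp !size_polyXn.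
Qed.

Lemma trunc_homP (M N : fdmod R) (f : 'M_(mdim N, mdim M)) :
  is_hom f <-> f *m mact M tvar = mact N tvar *m f.
Proof.
split=> [|fX a]; first exact.
rewrite (trunc_sum a) !linear_sum mulmx_suml; apply: eq_bigr => i _.
rewrite !linearZ -scalemxAl; congr (_ *: _); rewrite !mactX.
exact: intertwineX.
Qed.

Lemma mact_nilp (M : fdmod R) : mact M tvar ^+ p = 0.
Proof. by rewrite -mactX tvar_nilp linear0. Qed.

End Trunc.

Section Iso.
Variables (K : fieldType) (A : algType K).
Implicit Types M N L : fdmod A.

Lemma iso_refl M : mod_iso M M.
Proof. by exists 1%:M, 1%:M; split=> // [?|?||]; rewrite ?mulmx1 ?mul1mx. Qed.

Lemma iso_sym M N : mod_iso M N -> mod_iso N M.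
Proof. by case=> f [g [? ? ? ?]]; exists g, f. Qed.

Lemma hom_comp L M N (f : 'M_(mdim M, mdim L)) (g : 'M_(mdim N, mdim M)) :
  is_hom f -> is_hom g -> is_hom (g *m f).
Proof. by move=> hf hg a; rewrite -mulmxA hf !mulmxA hg. Qed.

Lemma iso_trans L M N : mod_iso L M -> mod_iso M N -> mod_iso L N.
Proof.
case=> f [f' [hf hf' ff' f'f]] [g [g' [hg hg' gg' g'g]]].
exists (g *m f), (f' *m g'); split; try exact: hom_comp.
- by rewrite mulmxA -(mulmxA g) ff' mulmx1.
- by rewrite mulmxA -(mulmxA f') g'g mulmx1.
Qed.

Lemma iso_dim M N : mod_iso M N -> mdim M = mdim N.
Proof.
case=> f [g [_ _ fg gf]].
have l m n (B : 'M[K]_(m, n)) C : B *m C = 1%:M -> (m <= n)%N.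
  move=> BC; rewrite -(mxrank1 K m) -BC (leq_trans (mxrankM_maxl _ _)) //.
  exact: rank_leq_col.
by apply/eqP; rewrite eqn_leq (l _ _ _ _ gf) (l _ _ _ _ fg).
Qed.

Lemma iso_rank M N a : mod_iso M N -> \rank (mact M a) = \rank (mact N a).
Proof.
have le L L' : mod_iso L L' -> (\rank (mact L a) <= \rank (mact L' a))%N.
  case=> f [g [hf hg fg gf]].
  have -> : mact L a = g *m mact L' a *m f by rewrite -mulmxA -hf mulmxA gf mul1mx.
  by rewrite (leq_trans (mxrankM_maxl _ _)) // mxrankM_maxr.
by move=> i; apply/eqP; rewrite eqn_leq !le //; apply: iso_sym.
Qed.

Lemma iso_dim0 M N : mdim M = 0%N -> mdim N = 0%N -> mod_iso M N.
Proof.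
move=> M0 N0.
have e m n (m0 : m = 0%N) (B C : 'M[K]_(m, n)) : B = C.
  by move: B C; rewrite m0 => B C; rewrite [B]flatmx0 [C]flatmx0.
by exists 0, 0; split=> [a|a||]; apply: e.
Qed.

Lemma hom_id M : is_hom (1%:M : 'M_(mdim M)).
Proof. by move=> a; rewrite mul1mx mulmx1. Qed.

Local Notation mx01 := (mul0mx, mulmx0, mul1mx, mulmx1, addr0, add0r).

Section Biproduct.
Variables M N : fdmod A.

Definition in1 : 'M[K]_(mdim (dsum M N), mdim M) := col_mx 1%:M 0.
Definition in2 : 'M[K]_(mdim (dsum M N), mdim N) := col_mx 0 1%:M.
Definition pr1 : 'M[K]_(mdim M, mdim (dsum M N)) := row_mx 1%:M 0.
Definition pr2 : 'M[K]_(mdim N, mdim (dsum M N)) := row_mx 0 1%:M.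

Lemma hom_in1 : is_hom in1.
Proof.
move=> a; rewrite /in1 /= /dsum_act mul_block_col mul_col_mx.
by rewrite !mulmx1 !mul1mx !mul0mx !mulmx0 !addr0.
Qed.

Lemma hom_in2 : is_hom in2.
Proof.
move=> a; rewrite /in2 /= /dsum_act mul_block_col mul_col_mx.
by rewrite !mulmx1 !mul1mx !mul0mx !mulmx0 !add0r.
Qed.

Lemma hom_pr1 : is_hom pr1.
Proof.
move=> a; rewrite /pr1 /= /dsum_act mul_row_block mul_mx_row.
by rewrite !mulmx1 !mul1mx !mul0mx !mulmx0 !addr0.
Qed.

Lemma hom_pr2 : is_hom pr2.
Proof.
move=> a; rewrite /pr2 /= /dsum_act mul_row_block mul_mx_row.
by rewrite !mulmx1 !mul1mx !mul0mx !mulmx0 !add0r.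
Qed.

Lemma pr1_in1 : pr1 *m in1 = 1%:M.
Proof. by rewrite /pr1 /in1 mul_row_col mulmx1 mulmx0 addr0. Qed.
Lemma pr2_in2 : pr2 *m in2 = 1%:M.
Proof. by rewrite /pr2 /in2 mul_row_col mulmx1 mulmx0 add0r. Qed.
Lemma pr1_in2 : pr1 *m in2 = 0.
Proof. by rewrite /pr1 /in2 mul_row_col mulmx0 mul0mx addr0. Qed.
Lemma pr2_in1 : pr2 *m in1 = 0.
Proof. by rewrite /pr2 /in1 mul_row_col mulmx0 mul0mx addr0. Qed.

Lemma pr1_in1K n (X : 'M[K]_(mdim M, n)) : pr1 *m (in1 *m X) = X.
Proof. by rewrite mulmxA pr1_in1 mul1mx. Qed.
Lemma pr2_in2K n (X : 'M[K]_(mdim N, n)) : pr2 *m (in2 *m X) = X.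
Proof. by rewrite mulmxA pr2_in2 mul1mx. Qed.
Lemma pr1_in2K n (X : 'M[K]_(mdim N, n)) : pr1 *m (in2 *m X) = 0.
Proof. by rewrite mulmxA pr1_in2 mul0mx. Qed.
Lemma pr2_in1K n (X : 'M[K]_(mdim M, n)) : pr2 *m (in1 *m X) = 0.
Proof. by rewrite mulmxA pr2_in1 mul0mx. Qed.

Lemma dsum_id : in1 *m pr1 + in2 *m pr2 = 1%:M.
Proof.
rewrite /in1 /pr1 /in2 /pr2 !mul_col_row !mulmx1 !mulmx0 ?mul0mx add_block_mx.
by rewrite !addr0 !add0r -scalar_mx_block.
Qed.

Lemma hom_add L L' (f g : 'M_(mdim L', mdim L)) :
  is_hom f -> is_hom g -> is_hom (f + g).
Proof. by move=> hf hg a; rewrite mulmxDl mulmxDr hf hg. Qed.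

(** Isomorphisms onto direct sums are built from inclusions and projections, so
    that the reshuffling of summands needs no block matrix computations. *)
Lemma biproduct_iso L (i1 : 'M_(mdim L, mdim M)) (i2 : 'M_(mdim L, mdim N))
    (p1 : 'M_(mdim M, mdim L)) (p2 : 'M_(mdim N, mdim L)) :
  is_hom i1 -> is_hom i2 -> is_hom p1 -> is_hom p2 ->
  p1 *m i1 = 1%:M -> p2 *m i2 = 1%:M -> p1 *m i2 = 0 -> p2 *m i1 = 0 ->
  i1 *m p1 + i2 *m p2 = 1%:M -> mod_iso L (dsum M N).
Proof.
move=> hi1 hi2 hp1 hp2 e11 e22 e12 e21 e1.
exists (in1 *m p1 + in2 *m p2), (i1 *m pr1 + i2 *m pr2); split.
- by apply: hom_add; apply: hom_comp => //; [exact: hom_in1 | exact: hom_in2].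
- by apply: hom_add; apply: hom_comp => //; [exact: hom_pr1 | exact: hom_pr2].
- rewrite mulmxDl !mulmxDr -!mulmxA !(mulmxA p1) !(mulmxA p2) e11 e12 e21 e22.
  by rewrite !mul0mx !mul1mx !mulmx0 addr0 add0r dsum_id.
- rewrite mulmxDl !mulmxDr -!mulmxA !(mulmxA pr1) !(mulmxA pr2).
  by rewrite pr1_in1 pr1_in2 pr2_in1 pr2_in2 !mul0mx !mul1mx !mulmx0 addr0 add0r.
Qed.

End Biproduct.

Definition bipE := (pr1_in1, pr2_in2, pr1_in2, pr2_in1,
  pr1_in1K, pr2_in2K, pr1_in2K, pr2_in1K).

Lemma dsum_iso M M' N N' :
  mod_iso M M' -> mod_iso N N' -> mod_iso (dsum M N) (dsum M' N').
Proof.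
case=> f [f' [hf hf' ff' f'f]] [g [g' [hg hg' gg' g'g]]].
apply: (@biproduct_iso _ _ _ (in1 _ _ *m f') (in2 _ _ *m g')
                          (f *m pr1 _ _) (g *m pr2 _ _));
  try by apply: hom_comp => //; (exact: hom_in1 || exact: hom_in2
       || exact: hom_pr1 || exact: hom_pr2).
- by rewrite mulmxA -(mulmxA f) pr1_in1 mulmx1.
- by rewrite mulmxA -(mulmxA g) pr2_in2 mulmx1.
- by rewrite mulmxA -(mulmxA f) pr1_in2 mulmx0 mul0mx.
- by rewrite mulmxA -(mulmxA g) pr2_in1 mulmx0 mul0mx.
- by rewrite !mulmxA -(mulmxA _ f') -(mulmxA _ g') f'f g'g !mulmx1 dsum_id.
Qed.

Lemma dsumCA_iso L M N : mod_iso (dsum L (dsum M N)) (dsum M (dsum L N)).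
Proof.
apply: (@biproduct_iso _ _ _
  (in2 _ _ *m in1 _ _) (in1 _ _ *m pr1 _ _ + in2 _ _ *m in2 _ _ *m pr2 _ _)
  (pr1 _ _ *m pr2 _ _) (in1 _ _ *m pr1 _ _ + in2 _ _ *m pr2 _ _ *m pr2 _ _)).
- by apply: hom_comp; [exact: hom_in1 | exact: hom_in2].
- by apply: hom_add; do ?[apply: hom_comp];
     (exact: hom_in1 || exact: hom_in2 || exact: hom_pr1 || exact: hom_pr2).
- by apply: hom_comp; [exact: hom_pr2 | exact: hom_pr1].
- by apply: hom_add; do ?[apply: hom_comp];
     (exact: hom_in1 || exact: hom_in2 || exact: hom_pr1 || exact: hom_pr2).
- by rewrite -!mulmxA !bipE.
- by rewrite mulmxDl !mulmxDr -!mulmxA !(bipE, mx01) dsum_id.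
- by rewrite !mulmxDr -!mulmxA !(bipE, mx01).
- by rewrite mulmxDl -!mulmxA !(bipE, mx01).
- rewrite mulmxDl !mulmxDr -!mulmxA !(bipE, mx01).
  rewrite addrCA -mulmxDr !(mulmxA (in1 M N)) !(mulmxA (in2 M N)) -mulmxDl.
  by rewrite dsum_id mul1mx dsum_id.
Qed.

Lemma dsumA_iso L M N : mod_iso (dsum L (dsum M N)) (dsum (dsum L M) N).
Proof.
apply: (@biproduct_iso _ _ _
  (in1 _ _ *m pr1 _ _ + in2 _ _ *m in1 _ _ *m pr2 _ _) (in2 _ _ *m in2 _ _)
  (in1 _ _ *m pr1 _ _ + in2 _ _ *m pr1 _ _ *m pr2 _ _) (pr2 _ _ *m pr2 _ _)).
- by apply: hom_add; do ?[apply: hom_comp];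
     (exact: hom_in1 || exact: hom_in2 || exact: hom_pr1 || exact: hom_pr2).
- by apply: hom_comp; exact: hom_in2.
- by apply: hom_add; do ?[apply: hom_comp];
     (exact: hom_in1 || exact: hom_in2 || exact: hom_pr1 || exact: hom_pr2).
- by apply: hom_comp; exact: hom_pr2.
- by rewrite mulmxDl !mulmxDr -!mulmxA !(bipE, mx01) dsum_id.
- by rewrite -!mulmxA !bipE.
- by rewrite mulmxDl -!mulmxA !(bipE, mx01).
- by rewrite !mulmxDr -!mulmxA !(bipE, mx01).
- rewrite mulmxDl !mulmxDr -!mulmxA !(bipE, mx01).
  rewrite -addrA -mulmxDr !(mulmxA (in1 M N)) !(mulmxA (in2 M N)) -mulmxDl.
  by rewrite dsum_id mul1mx dsum_id.
Qed.

(** The image of an idempotent endomorphism, written as U V with V U = 1. *)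
Section Retract.
Variables (M : fdmod A) (r : nat) (U : 'M[K]_(mdim M, r)) (V : 'M[K]_(r, mdim M)).
Hypotheses (VU : V *m U = 1%:M)
           (UV : forall a, U *m V *m mact M a = mact M a *m (U *m V)).

Definition retract_act (a : A) : 'M[K]_r := V *m mact M a *m U.
Fact retract_act_is_linear : linear retract_act.
Proof.
move=> c a b; rewrite /retract_act linearP mulmxDr mulmxDl.
by rewrite -scalemxAr -scalemxAl.
Qed.
HB.instance Definition _ :=
  GRing.isLinear.Build K A 'M[K]_r _ retract_act retract_act_is_linear.

Fact retract_act1 : retract_act 1 = 1%:M.
Proof. by rewrite /retract_act mact1 mulmx1 VU. Qed.
Fact retract_actM a b : retract_act (a * b) = retract_act a *m retract_act b.
Proof.
rewrite /retract_act mactM -!mulmxA; congr (V *m (mact M a *m _)).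
by rewrite (mulmxA U V) (mulmxA (U *m V)) UV -!mulmxA VU mulmx1.
Qed.
Definition retract : fdmod A := FdMod retract_act1 retract_actM.

Lemma hom_retract_in : @is_hom K A retract M U.
Proof. by move=> a; rewrite /= /retract_act !mulmxA UV -!mulmxA VU mulmx1. Qed.
Lemma hom_retract_out : @is_hom K A M retract V.
Proof.
by move=> a; rewrite /= /retract_act -!mulmxA -UV !mulmxA VU mul1mx.
Qed.
End Retract.

Lemma split_summand L M (f : 'M_(mdim M, mdim L)) (g : 'M_(mdim L, mdim M)) :
  is_hom f -> is_hom g -> g *m f = 1%:M ->
  exists M', mod_iso M (dsum L M').
Proof.
move=> hf hg gf; pose e := 1%:M - f *m g.
have ge : g *m e = 0 by rewrite mulmxBr mulmx1 mulmxA gf mul1mx subrr.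
have ef : e *m f = 0 by rewrite mulmxBl mul1mx -mulmxA gf mulmx1 subrr.
have ee : e *m e = e by rewrite {1}/e mulmxBl mul1mx -mulmxA ge mulmx0 subr0.
have he a : e *m mact M a = mact M a *m e.
  by rewrite mulmxBl mulmxBr mul1mx mulmx1 -mulmxA hg !mulmxA hf.
pose U := col_base e; pose V := row_base e.
have UV : U *m V = e by exact: mulmx_base.
have /row_freeP [V' VV'] := row_base_free e.
have /row_fullP [U' U'U] := col_base_full e.
rewrite -/V in VV'; rewrite -/U in U'U; move: (U) (V) UV => {}U {}V UV in VV' U'U *.
have VU : V *m U = 1%:M.
  have UVUV : U *m V *m (U *m V) = U *m V by rewrite UV.
  have : U' *m (U *m V *m (U *m V)) *m V' = 1%:M.
    by rewrite UVUV mulmxA U'U mul1mx VV'.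
  by rewrite -!mulmxA VV' mulmx1 (mulmxA U') U'U mul1mx.
have UVc a : U *m V *m mact M a = mact M a *m (U *m V) by rewrite UV he.
exists (retract VU UVc).
apply: (@biproduct_iso L (retract VU UVc) M f U g V) => //.
- exact: hom_retract_in.
- exact: hom_retract_out.
- by rewrite -[g *m U]mulmx1 -VV' mulmxA -(mulmxA g) UV ge mul0mx.
- by rewrite -[V *m f]mul1mx -U'U -!mulmxA (mulmxA U) UV ef mulmx0.
- by rewrite UV /e addrC subrK.
Qed.
End Iso.

(** * Jordan types and ranks *)

Section FormalSums.
Variable p : nat.

(** The number of blocks of size l + 1 is the second difference at l of the
    ranks of the powers of the matrix. *)
Lemma second_difference (a : {ffun 'I_p -> nat}) (l : 'I_p) :
  (\sum_(i < p) a i * (i.+1 - l) + \sum_(i < p) a i * (i.+1 - l.+2)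
   = a l + (\sum_(i < p) a i * (i.+1 - l.+1)).*2)%N.
Proof.
rewrite -big_split -addnn -big_split /= (bigD1 l) //= [in RHS](bigD1 l) //=.
rewrite [RHS]addnA; congr (_ + _)%N.
  by rewrite subSnn subnn (_ : l.+1 - l.+2 = 0)%N; lia.
apply: eq_bigr => i; rewrite -val_eqE /= -!mulnDr => ne; congr (_ * _)%N; lia.
Qed.

Lemma jt_rank q j : (0 < q <= p)%N ->
  (\sum_(i < p) jt p q i * (i.+1 - j) = q - j)%N.
Proof.
move=> /andP[q0 qp]; have lt_q : (q.-1 < p)%N by rewrite prednK.
rewrite (bigD1 (Ordinal lt_q)) //= big1 => [|i]; rewrite ffunE /= ?prednK //.
  by rewrite eqxx mul1n addn0.
rewrite -val_eqE /= => ne; rewrite (_ : _ == q = false) //.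
by apply/negbTE; apply: contra ne => /eqP <-.
Qed.

Lemma jt_rankMn q n j : (0 < q <= p)%N ->
  (\sum_(i < p) (jt p q *+ n) i * (i.+1 - j) = n * (q - j))%N.
Proof.
move=> hq; elim: n => [|n IH].
  by rewrite mulr0n mul0n big1 // => i _; rewrite ffunE.
rewrite mulrS mulSn -IH -(jt_rank j hq) -big_split; apply: eq_bigr => i _.
by rewrite ffunE mulnDl.
Qed.
End FormalSums.

Section Jordan.
Variables (K : fieldType) (p : nat).
Hypothesis p_gt0 : (0 < p)%N.
Local Notation R := (trunc_poly K p).
Local Notation t := (tvar K p).
Implicit Types (M : fdmod R) (a : {ffun 'I_p -> nat}).

Lemma jblock_tX (i : 'I_p) j (r c : 'I_i.+1) :
  mact (jblock K i) (t ^+ j) r c = (val r == c + j)%N%:R.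
Proof.
rewrite /= mxE.
have [lt_jp|le_pj] := ltnP j p; last first.
  rewrite -(subnK le_pj) exprD tvar_nilp // mulr0 /= coef0 if_same.
  by rewrite [_ == _](_ : _ = false) //; have := ltn_ord r; have := ltn_ord i; lia.
case: leqP => [le_cr|lt_rc]; first by rewrite coef_tvarX //; congr (_%:R); lia.
by rewrite [_ == _](_ : _ = false) //; lia.
Qed.

Lemma jblock_rank (i : 'I_p) j : \rank (mact (jblock K i) (t ^+ j)) = (i.+1 - j)%N.
Proof.
pose s := (i.+1 - j)%N.
pose B : 'M[K]_(i.+1, s) := \matrix_(r, c) (val r == c + j)%N%:R.
pose C : 'M[K]_(s, i.+1) := \matrix_(r, c) (val r == c)%:R.
have -> : mact (jblock K i) (t ^+ j) = B *m C.
  apply/matrixP => -[r /= lt_r] [c /= lt_c]; rewrite jblock_tX mxE /=.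
  have [lt_cs|le_sc] := ltnP c s.
    rewrite (bigD1 (Ordinal lt_cs)) //= !mxE /= eqxx mulr1 big1 ?addr0 // => l.
    by rewrite -val_eqE /= => /negPf ne; rewrite !mxE ne mulr0.
  rewrite big1 => [|l _].
    by rewrite [_ == _](_ : _ = false) //=; rewrite /s in le_sc; lia.
  have ne : (nat_of_ord l == c) = false by have := ltn_ord l; lia.
  by rewrite !mxE /= ne mulr0.
have CC : C *m C^T = 1%:M.
  apply/matrixP => r c; rewrite !mxE.
  have lt_ri : (r < i.+1)%N by have := ltn_ord r; rewrite /s; lia.
  rewrite (bigD1 (Ordinal lt_ri)) //= !mxE /= eqxx mul1r big1 ?addr0 => [|l].
    by rewrite eq_sym.
  by rewrite -val_eqE /= eq_sym => /negPf ne; rewrite !mxE ne mul0r.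
have BB : B^T *m B = 1%:M.
  apply/matrixP => r c; rewrite !mxE.
  have lt_ri : (r + j < i.+1)%N by have := ltn_ord r; rewrite /s; lia.
  rewrite (bigD1 (Ordinal lt_ri)) //= !mxE /= eqxx mul1r big1 ?addr0 => [|l].
    by rewrite eqn_add2r.
  by rewrite -val_eqE /= => /negPf ne; rewrite !mxE ne mul0r.
rewrite mxrankMfree; last by apply/row_freeP; exists C^T.
by apply/eqP; rewrite -[_ == _]/(row_full B); apply/row_fullP; exists B^T.
Qed.

Lemma jordan_rank a j :
  \rank (mact (jordan_mod K a) (t ^+ j)) = (\sum_(i < p) a i * (i.+1 - j))%N.
Proof.
have rkD M N b : \rank (mact (dsum M N) b) = (\rank (mact M b) + \rank (mact N b))%N.
  by rewrite /= /dsum_act rank_diag_block_mx.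
rewrite /jordan_mod.
elim/big_rec2: _ => [|i r M _ <-]; first by rewrite mxrank0.
rewrite rkD; congr (_ + _)%N.
elim: (a i) => [|n IH]; first by rewrite mxrank0.
by rewrite iterS rkD jblock_rank IH mulSn.
Qed.

Lemma jordan_mod_insert (i : 'I_p) a :
  mod_iso (dsum (jblock K i) (jordan_mod K a))
          (jordan_mod K [ffun l => (a l + (l == i))%N]).
Proof.
rewrite /jordan_mod; have := mem_index_enum i; have := index_enum_uniq 'I_p.
elim: (index_enum _) => [//|l s IH] /= /andP[l_s uniq_s].
rewrite !big_cons inE ffunE eq_sym; have [<- _|_ /= i_s] := eqVneq l i.
  rewrite addn1 iterS.
  set B := (X in mod_iso (dsum _ (dsum _ X)) _).
  set B' := (X in mod_iso _ (dsum _ X)).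
  suff -> : B' = B by exact: dsumA_iso.
  apply: eq_big_seq => l0 l0_s; rewrite ffunE.
  by case: eqP l0_s l_s => [->->|]; rewrite ?addn0.
rewrite addn0; apply: (iso_trans (dsumCA_iso _ _ _)).
by apply: dsum_iso; [exact: iso_refl | exact: IH].
Qed.

(** Existence of the Jordan form.  If i is the last exponent with X^i <> 0 and
    the (r0, c0) entry of X^i is nonzero, then e_c |-> X^c e_c0 embeds a block of
    size i + 1, and v |-> (e_r0^* X^(i-r) v)_r maps back onto it: the composite is
    triangular with that entry on the diagonal.  So the block splits off. *)
Lemma jordan_exists M : exists a, mod_iso M (jordan_mod K a).
Proof.
move: {2}(mdim M) (leqnn (mdim M)) => n; elim: n M => [|n IH] M.
  rewrite leqn0 => /eqP M0; exists [ffun=> 0%N]; apply: iso_dim0 => //.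
  rewrite /jordan_mod; elim/big_ind: _ => //= [N L -> -> //|i _].
  by rewrite ffunE.
have [le_mn _|lt_nm le_mn] := leqP (mdim M) n; first exact: IH.
pose X := mact M t.
have [|j /eqP Xj minj] := @ex_minnP (fun j => X ^+ j == 0).
  by exists p; apply/eqP; apply: mact_nilp.
have j_gt0 : (0 < j)%N.
  case: (j) Xj => // /matrixP Xj.
  pose o : 'I_(mdim M) := Ordinal (leq_trans (ltn0Sn n) lt_nm).
  by have /eqP := Xj o o; rewrite !mxE eqxx oner_eq0.
have le_jp : (j <= p)%N by apply: minj; apply/eqP; apply: mact_nilp.
have lt_ip : (j.-1 < p)%N by rewrite prednK.
pose i := Ordinal lt_ip.
have Xi1 e : (i < e)%N -> X ^+ e = 0.
  move=> /= lt_ie; rewrite (_ : e = e - j + j)%N ?mxXD ?Xj ?mulmx0 //.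
  by move: lt_ie; lia.
have /matrix0Pn [r0 [c0 Xrc]] : X ^+ i != 0.
  by apply/negP => /minj; rewrite /= -ltnS prednK // ltnn.
pose f : 'M[K]_(mdim M, i.+1) := \matrix_(r, c) (X ^+ c) r c0.
pose g : 'M[K]_(i.+1, mdim M) := \matrix_(r, c) (X ^+ (i - r)) r0 c.
have Jt (r c : 'I_i.+1) : mact (jblock K i) t r c = (val r == c.+1)%:R.
  by rewrite -[t]expr1 jblock_tX addn1.
have hf : @is_hom _ _ (jblock K i) M f.
  apply/trunc_homP/matrixP => r c; rewrite !mxE.
  transitivity ((X ^+ c.+1) r c0); last first.
    by rewrite mxXS mxE; apply: eq_bigr => l _; rewrite mxE.
  have [lt_ci|le_ic] := ltnP c i.
    rewrite (bigD1 (Ordinal (lt_ci : c.+1 < i.+1)%N)) //= Jt eqxx mulr1 mxE.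
    rewrite big1 ?addr0 // => l; rewrite -val_eqE /= => /negPf ne.
    by rewrite Jt ne mulr0.
  rewrite Xi1 ?mxE ?ltnS // big1 // => l _; rewrite Jt.
  have -> : (val l == c.+1) = false by rewrite ltn_eqF // (leq_trans (ltn_ord l)).
  by rewrite mulr0.
have hg : @is_hom _ _ M (jblock K i) g.
  apply/trunc_homP/matrixP => r c; rewrite !mxE.
  transitivity ((X ^+ (i - r).+1) r0 c).
    by rewrite mxXSr mxE; apply: eq_bigr => l _; rewrite mxE.
  case: r => [[|r] lt_r].
    by rewrite subn0 Xi1 // mxE big1 // => l _; rewrite Jt mul0r.
  rewrite (bigD1 (Ordinal (ltnW lt_r))) //= Jt /= eqxx mul1r mxE /= subnSK //.
  rewrite big1 ?addr0 // => l; rewrite -val_eqE /= => ne.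
  by rewrite Jt /= eqSS eq_sym (negPf ne) mul0r.
pose h : 'M[K]_i.+1 := g *m f.
have hE r c : h r c = (X ^+ (i - r + c)) r0 c0.
  by rewrite mxXD !mxE; apply: eq_bigr => l _; rewrite !mxE.
have hu : h \in unitmx.
  rewrite unitmxE unitfE det_trig.
    apply/prodf_neq0 => l _; rewrite hE subnK //; by have := ltn_ord l; rewrite ltnS.
  apply/is_trig_mxP => r c lt_rc; rewrite hE Xi1 ?mxE //.
  by have := ltn_ord c; lia.
have hh : @is_hom _ _ (jblock K i) (jblock K i) (invmx h).
  have hjh : @is_hom _ _ (jblock K i) (jblock K i) h := hom_comp hf hg.
  by move=> a; rewrite -[RHS](mulKmx hu) (mulmxA h) hjh -mulmxA mulmxV // mulmx1.
have gfh : g *m (f *m invmx h) = 1%:M by rewrite mulmxA mulmxV.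
have [M' iM'] := split_summand (hom_comp hh hf) hg gfh.
have dM' : (mdim M' <= n)%N by have /= := iso_dim iM'; move: le_mn; lia.
have [a ia] := IH _ dM'.
exists [ffun l => (a l + (l == i))%N]; apply: iso_trans iM' _.
apply: iso_trans (jordan_mod_insert _ _).
by apply: dsum_iso ia; exact: iso_refl.
Qed.

Theorem jordan_typeP M a :
  has_jordan_type M a <->
  forall j, \rank (mact M t ^+ j) = (\sum_(i < p) a i * (i.+1 - j))%N.
Proof.
split=> [iM j|rkM]; first by rewrite -mactX (iso_rank _ iM) jordan_rank.
have [b ib] := jordan_exists M.
have rkb j : \rank (mact M t ^+ j) = (\sum_(i < p) b i * (i.+1 - j))%N.
  by rewrite -mactX (iso_rank _ ib) jordan_rank.
suff -> : a = b by [].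
apply/ffunP => l; have := second_difference a l.
by rewrite -!rkM !rkb second_difference => /addIn.
Qed.

End Jordan.

(** * The rings k[G] and k[G] (x) k[G] *)

Lemma sum_mxtens (V : nmodType) m n (F : 'I_(m * n) -> V) :
  \sum_i F i = \sum_i \sum_j F (mxtens_index (i, j)).
Proof.
rewrite (reindex (@mxtens_index m n)) /=; last first.
  exists (@mxtens_unindex m n) => i _.
    exact: mxtens_indexK.
  exact: mxtens_unindexK.
by rewrite pair_bigA /=; apply: eq_bigr => -[i j].
Qed.

Section Coord.
Variables (k : fieldType) (G : finGroupScheme k).
Local Notation n := (gsdim G).

Definition coord : Type := 'cV[k]_n.
HB.instance Definition _ := GRing.Lmodule.copy coord 'cV[k]_n.

Definition coord_mul (a b : coord) : coord := gs_mul G *m (a *t b).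
Definition coord_one : coord := gs_unit G.

Lemma coord_mulE (a b : coord) (s : 'I_n) :
  (coord_mul a b : 'cV_n) s 0 =
  \sum_i \sum_j gs_mul G s (mxtens_index (i, j)) *
    ((a : 'cV_n) i 0 * (b : 'cV_n) j 0).
Proof.
rewrite mxE sum_mxtens; apply: eq_bigr => i _; apply: eq_bigr => j _.
congr (_ * _).
by rewrite !mxE !mxtens_indexK /=; congr (_ * _); rewrite ord1.
Qed.

Fact coord_mulA : associative coord_mul.
Proof.
move=> f g h; rewrite /coord_mul.
have -> : f *t (gs_mul G *m (g *t h))
    = (1%:M *t gs_mul G) *m (f *t (g *t h)).
  by rewrite tensmx_mul mul1mx.
have -> : (gs_mul G *m (f *t g) : 'M_(_, 1 * 1)) *t h
    = (gs_mul G *t 1%:M) *m ((f *t g) *t h).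
  by rewrite tensmx_mul mul1mx.
rewrite !mulmxA -gs_mulA tensmxA.
set X := gs_mul G *m _; set Y := f *t (g *t h).
have E a b (e : a = b) (X' : 'M[k]_(n, b)) c d (ec : c = d) (Y' : 'M[k]_(a, c)) :
    castmx (erefl, esym e) X' *m Y'
    = castmx (erefl, esym ec) (X' *m castmx (e, ec) Y').
  by case: b / e X'; case: d / ec => X'; rewrite !castmx_id.
rewrite (E _ _ _ _ _ _ (mulnA 1 1 1)).
by apply/matrixP => i j; rewrite castmxE; congr ((X *m _) _ _); apply: val_inj.
Qed.

Fact coord_mulC : commutative coord_mul.
Proof.
move=> f g; rewrite /coord_mul -{1}gs_mulC -mulmxA; congr (_ *m _).
apply/matrixP => i j; case: (mxtens_indexP i) => a b.
rewrite mxE (bigD1 (mxtens_index (b, a))) //= big1 => [|l ne].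
  rewrite !mxE /swap_index !mxtens_indexK /= eqxx mul1r addr0 mulrC.
  by congr (g _ _ * f _ _); apply: val_inj; rewrite !ord1.
rewrite mxE [_ == _](_ : _ = false) ?mul0r //.
apply: contraNF ne; case: (mxtens_indexP l) => c d.
rewrite /swap_index mxtens_indexK => /eqP /(can_inj (@mxtens_indexK _ _)).
by case=> -> ->.
Qed.

Fact coord_mul1 : left_id coord_one coord_mul.
Proof.
move=> f; rewrite /coord_mul /coord_one.
have -> : gs_unit G *t f = (gs_unit G *t 1%:M) *m (1%:M *t f).
  by rewrite tensmx_mul mul1mx mulmx1.
rewrite mulmxA.
have E a b (e : a = b) (X : 'M[k]_(n, a)) (Y : 'M[k]_(a, 1)) :
   X *m Y = castmx (erefl, e) X *m castmx (e, erefl) Y.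
  by case: b / e; rewrite !castmx_id.
rewrite (E _ _ (mul1n n)) gs_mul1 mul1mx.
apply/matrixP => i j; rewrite castmxE tens_scalar1mx castmxE.
by congr (f _ _); apply: val_inj; rewrite ?ord1.
Qed.

Fact coord_mulDl : left_distributive coord_mul +%R.
Proof.
move=> f g h; rewrite /coord_mul -mulmxDr; congr (_ *m _).
by apply/matrixP => i j; rewrite !mxE mulrDl.
Qed.

Fact coord_one_neq0 : coord_one != 0.
Proof.
apply/eqP => /(congr1 (fun f : 'cV_n => (gs_counit G *m f) 0 0)).
rewrite /coord_one gs_counit_unit mulmx0 !mxE => /eqP.
by rewrite oner_eq0.
Qed.

HB.instance Definition _ := GRing.Zmodule_isComNzRing.Build coord
  coord_mulA coord_mulC coord_mul1 coord_mulDl coord_one_neq0.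

Fact coord_scaleAl (c : k) (f g : coord) : c *: (f * g) = (c *: f) * g.
Proof.
rewrite /GRing.mul /= /coord_mul scalemxAr; congr (_ *m _).
by apply/matrixP => i j; rewrite !mxE mulrA.
Qed.

HB.instance Definition _ := GRing.Lmodule_isLalgebra.Build k coord coord_scaleAl.
HB.instance Definition _ := GRing.Lalgebra_isComAlgebra.Build k coord.

Definition lmul (a : coord) : 'M[k]_n :=
  \matrix_(s, j) \sum_i gs_mul G s (mxtens_index (i, j)) * (a : 'cV_n) i 0.

Lemma lmulE (a b : coord) : lmul a *m b = a * b.
Proof.
apply/matrixP => s z; rewrite ord1 coord_mulE mxE exchange_big.
apply: eq_bigr => j _; rewrite mxE mulr_suml; apply: eq_bigr => i _.
by rewrite mulrA.
Qed.

Lemma lmulP (a : coord) (X : 'M[k]_n) :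
  (forall b : coord, X *m b = a * b) -> X = lmul a.
Proof.
move=> XE; apply/matrixP => i j.
have := XE (delta_mx j 0); rewrite -lmulE -!colE => /matrixP /(_ i 0).
by rewrite !mxE.
Qed.

Lemma lmulM a b : lmul (a * b) = lmul a *m lmul b.
Proof. by apply/esym/lmulP => c; rewrite -mulmxA !lmulE mulrA. Qed.

Lemma lmulC a b : lmul a *m lmul b = lmul b *m lmul a.
Proof. by rewrite -!lmulM mulrC. Qed.

Lemma lmul1 : lmul 1 = 1%:M.
Proof. by apply/esym/lmulP => c; rewrite mul1mx mul1r. Qed.

Fact lmul_is_linear : linear lmul.
Proof.
move=> c a b; apply/esym/lmulP => d.
by rewrite mulmxDl -scalemxAl !lmulE mulrDl -scalerAl.
Qed.
HB.instance Definition _ :=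
  GRing.isLinear.Build k coord 'M[k]_n _ lmul lmul_is_linear.

Definition coord_basis (i : 'I_n) : coord := delta_mx i 0.

Lemma coord_basisE (a : coord) : a = \sum_i (a : 'cV_n) i 0 *: coord_basis i.
Proof.
by rewrite [LHS]matrix_sum_delta; apply: eq_bigr => i _; rewrite big_ord1.
Qed.

(** The ring k[G] (x) k[G] on n x n matrices, the entry (s, t) being the
    coordinate on e_s (x) e_t; unlike column vectors of height n * n this makes
    the two partial evaluations plain matrix products. *)
Definition coord2 : Type := 'M[k]_n.
HB.instance Definition _ := GRing.Lmodule.copy coord2 'M[k]_n.

Definition tens (a b : coord) : coord2 := (a : 'cV_n) *m (b : 'cV_n)^T.

Definition coord2_mul (V W : coord2) : coord2 :=
  \sum_i \sum_j (V : 'M_n) i j *: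
    (lmul (coord_basis i) *m W *m (lmul (coord_basis j))^T).
Definition coord2_one : coord2 := tens 1 1.

Lemma tens_sum (W : coord2) :
  W = \sum_i \sum_j (W : 'M_n) i j *: tens (coord_basis i) (coord_basis j).
Proof.
rewrite [LHS]matrix_sum_delta; apply: eq_bigr => i _; apply: eq_bigr => j _.
by congr (_ *: _); rewrite /tens /coord_basis trmx_delta mul_delta_mx.
Qed.

Lemma coord2_mul_tens a b W :
  coord2_mul (tens a b) W = lmul a *m W *m (lmul b)^T.
Proof.
have lE c : lmul c = \sum_i (c : 'cV_n) i 0 *: lmul (coord_basis i).
  by rewrite {1}(coord_basisE c) linear_sum; apply: eq_bigr => i _; rewrite linearZ.
have lET c : (lmul c)^T = \sum_i (c : 'cV_n) i 0 *: (lmul (coord_basis i))^T.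
  by rewrite (lE c) linear_sum; apply: eq_bigr => i _; rewrite linearZ.
rewrite (lE a) (lET b) mulmx_suml mulmx_suml /coord2_mul; apply: eq_bigr => i _.
rewrite mulmx_sumr; apply: eq_bigr => j _.
rewrite -!scalemxAl -scalemxAr scalerA; congr (_ *: _).
by rewrite mxE big_ord1 !mxE.
Qed.

(** Associativity is deduced from this and from the fact that multiplication
    operators commute with each other ([coord2_mulCA]). *)
Fact coord2_mulC : commutative coord2_mul.
Proof.
have E V W : coord2_mul V W = \sum_(a : 'I_n * 'I_n) \sum_(b : 'I_n * 'I_n)
    ((V : 'M_n) a.1 a.2 * (W : 'M_n) b.1 b.2) *:
    tens (coord_basis a.1 * coord_basis b.1) (coord_basis a.2 * coord_basis b.2).
  rewrite /coord2_mul pair_bigA; apply: eq_bigr => -[i j] _ /=.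
  rewrite [in LHS](tens_sum W) pair_bigA mulmx_sumr mulmx_suml scaler_sumr.
  apply: eq_bigr => -[u v] _ /=.
  rewrite -scalemxAr -scalemxAl scalerA; congr (_ *: _).
  rewrite /tens -(lmulE _ (coord_basis u)) -(lmulE _ (coord_basis v)).
  by rewrite trmx_mul !mulmxA.
move=> V W; rewrite !E exchange_big; apply: eq_bigr => a _; apply: eq_bigr => b _.
by rewrite mulrC (mulrC (coord_basis _)) (mulrC (coord_basis b.2)).
Qed.

Fact coord2_mul1 : left_id coord2_one coord2_mul.
Proof. by move=> W; rewrite coord2_mul_tens lmul1 trmx1 mulmx1 mul1mx. Qed.

Fact coord2_mulDl : left_distributive coord2_mul +%R.
Proof.
move=> U V W; rewrite /coord2_mul -big_split; apply: eq_bigr => i _.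
by rewrite -big_split; apply: eq_bigr => j _; rewrite mxE scalerDl.
Qed.

Let coord2_mulCA U V W :
  coord2_mul U (coord2_mul V W) = coord2_mul V (coord2_mul U W).
Proof.
have E X Y : coord2_mul X (coord2_mul Y W) =
    \sum_(a : 'I_n * 'I_n) \sum_(b : 'I_n * 'I_n)
    ((X : 'M_n) a.1 a.2 * (Y : 'M_n) b.1 b.2) *:
    (lmul (coord_basis a.1) *m lmul (coord_basis b.1) *m W
     *m (lmul (coord_basis a.2) *m lmul (coord_basis b.2))^T).
  rewrite /coord2_mul pair_bigA; apply: eq_bigr => -[i j] _ /=.
  rewrite pair_bigA mulmx_sumr mulmx_suml scaler_sumr; apply: eq_bigr => -[u v] _ /=.
  by rewrite -scalemxAr -scalemxAl scalerA trmx_mul !mulmxA.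
rewrite !E exchange_big; apply: eq_bigr => a _; apply: eq_bigr => b _.
by rewrite mulrC (lmulC (coord_basis _)) (lmulC (coord_basis b.2)).
Qed.

Fact coord2_mulA : associative coord2_mul.
Proof.
move=> U V W; rewrite [RHS]coord2_mulC [RHS]coord2_mulCA; congr coord2_mul.
exact: coord2_mulC.
Qed.

Fact coord2_one_neq0 : coord2_one != 0.
Proof.
apply/eqP => /(congr1 (fun W : 'M_n => (gs_counit G *m W *m (gs_counit G)^T) 0 0)).
rewrite /coord2_one /tens mulmxA gs_counit_unit mul1mx -trmx_mul gs_counit_unit.
by rewrite trmx1 mulmx0 mul0mx !mxE => /eqP; rewrite oner_eq0.
Qed.

HB.instance Definition _ := GRing.Zmodule_isComNzRing.Build coord2
  coord2_mulA coord2_mulC coord2_mul1 coord2_mulDl coord2_one_neq0.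

Lemma tensME a b (W : coord2) : tens a b * W = lmul a *m W *m (lmul b)^T.
Proof. exact: coord2_mul_tens. Qed.

Lemma tensM a b c d : tens a b * tens c d = tens (a * c) (b * d).
Proof.
by rewrite tensME /tens -(lmulE a) -(lmulE b) trmx_mul !mulmxA.
Qed.

Definition inj1 (a : coord) : coord2 := tens a 1.
Definition inj2 (a : coord) : coord2 := tens 1 a.
Definition comul (a : coord) : coord2 :=
  \matrix_(s, t) (gs_comul G *m (a : 'cV_n)) (mxtens_index (s, t)) 0.

Fact inj1_is_zmod_morphism : zmod_morphism inj1.
Proof. by move=> a b; rewrite /inj1 /tens mulmxBl. Qed.
Fact inj1_is_monoid_morphism : monoid_morphism inj1.
Proof. by split=> // a b; rewrite /inj1 tensM mulr1. Qed.
HB.instance Definition _ :=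
  GRing.isZmodMorphism.Build coord coord2 inj1 inj1_is_zmod_morphism.
HB.instance Definition _ :=
  GRing.isMonoidMorphism.Build coord coord2 inj1 inj1_is_monoid_morphism.

Fact inj2_is_zmod_morphism : zmod_morphism inj2.
Proof. by move=> a b; rewrite /inj2 /tens linearB /= mulmxBr. Qed.
Fact inj2_is_monoid_morphism : monoid_morphism inj2.
Proof. by split=> // a b; rewrite /inj2 tensM mulr1. Qed.
HB.instance Definition _ :=
  GRing.isZmodMorphism.Build coord coord2 inj2 inj2_is_zmod_morphism.
HB.instance Definition _ :=
  GRing.isMonoidMorphism.Build coord coord2 inj2 inj2_is_monoid_morphism.

Lemma inj12 a b : inj1 a * inj2 b = tens a b.
Proof. by rewrite tensM mulr1 mul1r. Qed.

Lemma coord2_mulE (V W : coord2) s t : (V * W : 'M_n) s t =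
  \sum_i \sum_j \sum_u \sum_v (V : 'M_n) i j * (W : 'M_n) u v *
    (gs_mul G s (mxtens_index (i, u)) * gs_mul G t (mxtens_index (j, v))).
Proof.
have lb i a b : lmul (coord_basis i) a b = gs_mul G a (mxtens_index (i, b)).
  rewrite mxE (bigD1 i) //= mxE !eqxx mulr1 big1 ?addr0 // => l /negPf ne.
  by rewrite mxE ne mulr0.
rewrite [V * W]/(coord2_mul V W) /coord2_mul summxE; apply: eq_bigr => i _.
rewrite summxE; apply: eq_bigr => j _; rewrite mxE -mulmxA mxE mulr_sumr.
apply: eq_bigr => u _; rewrite lb [X in _ * (_ * X)]mxE !mulr_sumr.
apply: eq_bigr => v _; rewrite [_^T _ _]mxE lb; ring.
Qed.

Fact comul_is_zmod_morphism : zmod_morphism comul.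
Proof.
move=> a b; apply/matrixP => s t; rewrite !mxE -sumrB.
by apply: eq_bigr => i _; rewrite !mxE mulrBr.
Qed.

Lemma midswap_mxE (w : 'cV[k]_((n * n) * (n * n))) a b c d :
  (midswap_mx k n *m w)
    (mxtens_index (mxtens_index (a, c), mxtens_index (b, d))) 0
  = w (mxtens_index (mxtens_index (a, b), mxtens_index (c, d))) 0.
Proof.
rewrite mxE (bigD1 (mxtens_index (mxtens_index (a, b), mxtens_index (c, d)))) //=.
rewrite mxE /midswap_index !mxtens_indexK /= eqxx mul1r big1 ?addr0 // => l ne.
rewrite mxE [_ == _](_ : _ = false) ?mul0r //.
apply: contraNF ne.
case: (mxtens_indexP l) => l1 l2; case: (mxtens_indexP l1) => a' b'.
case: (mxtens_indexP l2) => c' d'; rewrite /midswap_index !mxtens_indexK.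
have inj m1 m2 := can_inj (@mxtens_indexK m1 m2).
move=> /eqP /inj E; have /inj [-> ->] := congr1 fst E.
by have /inj [-> ->] := congr1 snd E.
Qed.

Lemma comulZ c a : comul (c *: a) = c *: comul a.
Proof.
apply/matrixP => s t; rewrite !mxE mulr_sumr; apply: eq_bigr => i _.
by rewrite mxE mulrCA.
Qed.

Lemma tensZr c a b : tens a (c *: b) = c *: tens a b.
Proof. by rewrite /tens linearZ -scalemxAr. Qed.

Fact comul_is_monoid_morphism : monoid_morphism comul.
Proof.
split=> [|a b].
  apply/matrixP => s t; rewrite mxE /= gs_comul_unit.
  rewrite [LHS]mxE !mxtens_indexK /= [RHS]mxE big_ord1 [X in _ = _ * X]mxE.
  by congr (gs_unit G _ _ * gs_unit G _ _); rewrite !ord1.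
apply/matrixP => s t; rewrite coord2_mulE mxE.
have -> : gs_comul G *m (a * b : coord) = (gs_mul G *t gs_mul G) *m
    (midswap_mx k n *m ((gs_comul G *m (a : 'cV_n)) *t (gs_comul G *m (b : 'cV_n)))).
  rewrite -tensmx_mul -[a * b]/(coord_mul a b) /coord_mul [LHS]mulmxA gs_comulM.
  by rewrite -!mulmxA.
rewrite mxE sum_mxtens.
transitivity (\sum_i \sum_u \sum_j \sum_v
   (comul a : 'M_n) i j * (comul b : 'M_n) u v *
    (gs_mul G s (mxtens_index (i, u)) * gs_mul G t (mxtens_index (j, v)))).
  rewrite sum_mxtens; apply: eq_bigr => i _; apply: eq_bigr => u _.
  rewrite sum_mxtens; apply: eq_bigr => j _; apply: eq_bigr => v _.
  rewrite midswap_mxE tensmxE mulrC; congr (_ * _).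
  rewrite [LHS]mxE !mxtens_indexK /= [X in _ = X * _]mxE [X in _ = _ * X]mxE.
  by rewrite !(ord1 (Ordinal _)).
by apply: eq_bigr => i _; rewrite exchange_big.
Qed.
HB.instance Definition _ :=
  GRing.isZmodMorphism.Build coord coord2 comul comul_is_zmod_morphism.
HB.instance Definition _ :=
  GRing.isMonoidMorphism.Build coord coord2 comul comul_is_monoid_morphism.

Local Notation kG := (group_algebra G).

(** Elements of kG are functionals on k[G]; [ev1] and [ev2] apply one to the
    left, respectively right, factor of k[G] (x) k[G]. *)
Definition ev (x : kG) (a : coord) : k := ((x : 'rV_n) *m (a : 'cV_n)) 0 0.
Definition ev1 (x : kG) (W : coord2) : coord := (W : 'M_n)^T *m (x : 'rV_n)^T.
Definition ev2 (x : kG) (W : coord2) : coord := (W : 'M_n) *m (x : 'rV_n)^T.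

Fact ev_is_linear x : linear_for *%R (ev x).
Proof. by move=> c a b; rewrite /ev mulmxDr -scalemxAr !mxE. Qed.
HB.instance Definition _ x :=
  GRing.isLinear.Build k coord k *%R (ev x) (ev_is_linear x).
Fact ev1_is_linear x : linear (ev1 x).
Proof. by move=> c a b; rewrite /ev1 linearP /= mulmxDl -scalemxAl. Qed.
HB.instance Definition _ x :=
  GRing.isLinear.Build k coord2 coord _ (ev1 x) (ev1_is_linear x).
Fact ev2_is_linear x : linear (ev2 x).
Proof. by move=> c a b; rewrite /ev2 mulmxDl -scalemxAl. Qed.
HB.instance Definition _ x :=
  GRing.isLinear.Build k coord2 coord _ (ev2 x) (ev2_is_linear x).

Lemma ev_basis x i : ev x (coord_basis i) = (x : 'rV_n) 0 i.
Proof. by rewrite /ev -colE mxE. Qed.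

Lemma ev_ga_basis (a : coord) i : ev (ga_basis i) a = (a : 'cV_n) i 0.
Proof. by rewrite /ev -rowE mxE. Qed.

Lemma ev_inj (a b : coord) : (forall x, ev x a = ev x b) -> a = b.
Proof.
move=> E; apply/matrixP => i j; rewrite ord1.
by have := E (ga_basis i); rewrite !ev_ga_basis.
Qed.

Lemma evZl c x a : ev (c *: x) a = c * ev x a.
Proof. by rewrite /ev -scalemxAl mxE. Qed.
Lemma ev_suml I (s : seq I) (F : I -> kG) a :
  ev (\sum_(i <- s) F i) a = \sum_(i <- s) ev (F i) a.
Proof. by rewrite /ev mulmx_suml summxE. Qed.

Lemma ev_lmul (x : kG) b a : ev (x *m lmul b) a = ev x (b * a).
Proof. by rewrite /ev -mulmxA lmulE. Qed.

Lemma ev1_tens x a b : ev1 x (tens a b) = ev x a *: b.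
Proof.
rewrite /ev1 /tens trmx_mul trmxK -mulmxA -trmx_mul [X in _ *m X^T]mx11_scalar.
by rewrite tr_scalar_mx mul_mx_scalar.
Qed.
Lemma ev2_tens x a b : ev2 x (tens a b) = ev x b *: a.
Proof.
rewrite /ev2 /tens -mulmxA -trmx_mul [X in _ *m X^T]mx11_scalar.
by rewrite tr_scalar_mx mul_mx_scalar.
Qed.
Lemma ev1M x a W : ev1 x (inj2 a * W) = a * ev1 x W.
Proof. by rewrite /ev1 tensME lmul1 mul1mx trmx_mul trmxK -mulmxA lmulE. Qed.
Lemma ev2M x a W : ev2 x (inj1 a * W) = a * ev2 x W.
Proof. by rewrite /ev2 tensME lmul1 trmx1 mulmx1 -mulmxA lmulE. Qed.
Lemma ev2_inj2 x a W : ev2 x (inj2 a * W) = ev2 (x *m lmul a) W.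
Proof. by rewrite /ev2 tensME lmul1 mul1mx trmx_mul mulmxA. Qed.

Lemma ev_mul (x y : kG) a : ev (x * y) a = ev x (ev2 y (comul a)).
Proof.
rewrite /ev -[x * y]/(ga_mul x y) /ga_mul -mulmxA mxE sum_mxtens mxE.
apply: eq_bigr => i _; rewrite mxE mulr_sumr; apply: eq_bigr => j _.
by rewrite !mxE !mxtens_indexK /= -mulrA [_ * y _ _]mulrC !ord1.
Qed.

Lemma ev_mul1 (x y : kG) a : ev (x * y) a = ev y (ev1 x (comul a)).
Proof.
rewrite /ev -[x * y]/(ga_mul x y) /ga_mul -mulmxA mxE sum_mxtens mxE exchange_big.
apply: eq_bigr => j _; rewrite mxE mulr_sumr; apply: eq_bigr => i _.
by rewrite !mxE !mxtens_indexK /= mulrA [LHS]mulrC !ord1; ring.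
Qed.

Lemma comulE a s t : (comul a : 'M_n) s t = ev (ga_basis s * ga_basis t) a.
Proof. by rewrite ev_mul ev_ga_basis /ev2 /ga_basis trmx_delta -colE [RHS]mxE. Qed.

Lemma ev_one (a : coord) : ev 1 a = (gs_counit G *m (a : 'cV_n)) 0 0.
Proof. by []. Qed.

Definition antip (a : coord) : coord := gs_antipode G *m (a : 'cV_n).
Fact antip_is_linear : linear antip.
Proof. by move=> c a b; rewrite /antip mulmxDr -scalemxAr. Qed.
HB.instance Definition _ :=
  GRing.isLinear.Build k coord coord _ antip antip_is_linear.

(** * The generic point acting on a module *)

Section Generic.
Variable M : fdmod kG.
Local Notation m := (mdim M).

(** The matrix over k[G] by which the generic point of G acts on M: evaluating
    its entries at x in kG gives the action of x. *)
Definition gpt : 'M[coord]_m :=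
  \matrix_(i, j) \col_(t < n) mact M (ga_basis t) i j.
Definition gptV : 'M[coord]_m := map_mx antip gpt.

Lemma ev_gpt x i j : ev x (gpt i j) = mact M x i j.
Proof.
rewrite {2}(ga_basisE x) linear_sum summxE /ev mxE.
by apply: eq_bigr => t _; rewrite linearZ !mxE.
Qed.

(** The generic point is group-like. *)
Lemma comul_gpt : map_mx comul gpt = map_mx inj1 gpt *m map_mx inj2 gpt.
Proof.
apply/matrixP => i j; rewrite [LHS]mxE [RHS]mxE; apply/matrixP => s t.
rewrite comulE ev_gpt mactM mxE summxE; apply: eq_bigr => l _.
by rewrite [map_mx inj1 _ _ _]mxE [map_mx inj2 _ _ _]mxE inj12 [RHS]mxE big_ord1 !mxE.
Qed.

Lemma ev_1_gpt i j : ev 1 (gpt i j) = (i == j)%:R.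
Proof. by rewrite ev_gpt mact1 mxE. Qed.

Lemma comul_vec i j : gs_comul G *m (gpt i j : 'cV_n) =
  \sum_l (gpt i l : 'cV_n) *t (gpt l j : 'cV_n).
Proof.
apply/matrixP => st z; rewrite (ord1 z) summxE.
case: (mxtens_indexP st) => s t.
have /matrixP/(_ i j) := comul_gpt; rewrite [LHS]mxE [RHS]mxE.
move=> /matrixP/(_ s t); rewrite [LHS]mxE => ->; rewrite summxE.
apply: eq_bigr => l _.
rewrite [map_mx inj1 _ _ _]mxE [map_mx inj2 _ _ _]mxE inj12 [LHS]mxE big_ord1.
by rewrite [RHS]mxE !mxtens_indexK /= [X in _ * X = _]mxE !(ord1 (Ordinal _)).
Qed.

Lemma gpt_mulV : gpt *m gptV = 1%:M.
Proof.
apply/matrixP => i j; rewrite [LHS]mxE.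
transitivity (gs_unit G *m gs_counit G *m (gpt i j : 'cV_n)); last first.
  rewrite -mulmxA [_ *m gpt i j]mx11_scalar mul_mx_scalar -ev_one ev_1_gpt mxE.
  by case: (i == j); rewrite ?scale1r ?scale0r.
rewrite -gs_antipoder -!mulmxA comul_vec !mulmx_sumr; apply: eq_bigr => l _.
rewrite [gptV l j]mxE.
by rewrite (tensmx_mul 1%:M (gs_antipode G) (gpt i l : 'cV_n) (gpt l j)) mul1mx.
Qed.
Lemma gpt_Vmul : gptV *m gpt = 1%:M.
Proof.
apply/matrixP => i j; rewrite [LHS]mxE.
transitivity (gs_unit G *m gs_counit G *m (gpt i j : 'cV_n)); last first.
  rewrite -mulmxA [_ *m gpt i j]mx11_scalar mul_mx_scalar -ev_one ev_1_gpt mxE.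
  by case: (i == j); rewrite ?scale1r ?scale0r.
rewrite -gs_antipodel -!mulmxA comul_vec !mulmx_sumr; apply: eq_bigr => l _.
rewrite [gptV i l]mxE.
by rewrite (tensmx_mul (gs_antipode G) 1%:M (gpt i l : 'cV_n) (gpt l j)) mul1mx.
Qed.

Lemma inj2_gpt : map_mx inj2 gpt = map_mx inj1 gptV *m map_mx comul gpt.
Proof. by rewrite comul_gpt mulmxA -map_mxM gpt_Vmul map_mx1 mul1mx. Qed.

Lemma inj1_gpt : map_mx inj1 gpt = map_mx comul gpt *m map_mx inj2 gptV.
Proof. by rewrite comul_gpt -mulmxA -map_mxM gpt_mulV map_mx1 mulmx1. Qed.

(** A ring morphism preserves inverses of matrices, so the coproduct of the
    antipode follows, on these coefficients, from multiplicativity alone. *)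
Lemma comul_gptV : map_mx comul gptV = map_mx inj2 gptV *m map_mx inj1 gptV.
Proof.
rewrite -[RHS]mulmx1 -(map_mx1 comul) -gpt_mulV map_mxM comul_gpt.
rewrite !mulmxA -(mulmxA (map_mx inj2 gptV)) -map_mxM gpt_Vmul map_mx1 mulmx1.
by rewrite -map_mxM gpt_Vmul map_mx1 mul1mx.
Qed.
End Generic.

(** * Casimir families, integrals and semisimplicity *)

(** The sigma_ij encode the map e_j |-> \sum_i sigma_ij (x) e_i from P to
    kG (x) P: the first equation says that it is a homomorphism, the second that
    it is a section of the action map kG (x) P -> P. *)
Definition casimir (P : fdmod kG) (sigma : 'I_(mdim P) -> 'I_(mdim P) -> kG) :=
  (forall x i j, x * sigma i j = \sum_w mact P x w j *: sigma i w) /\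
  (forall i j, \sum_l mact P (sigma l j) i l = (i == j)%:R).

(** Dually, the rho_ij encode a homomorphism from Hom_k(kG, I) to I which is a
    retraction of the embedding v |-> (x |-> x v). *)
Definition cocasimir (I : fdmod kG) (rho : 'I_(mdim I) -> 'I_(mdim I) -> kG) :=
  (forall x i j, rho i j * x = \sum_w mact I x i w *: rho w j) /\
  (forall i j, \sum_l mact I (rho i l) l j = (i == j)%:R).

Section Integral.
Variables (P : fdmod kG) (sigma : 'I_(mdim P) -> 'I_(mdim P) -> kG).
Hypothesis cas : casimir sigma.

Lemma casimir_comul i j b :
  ev2 (sigma i j) (comul b) = \sum_w ev (sigma i w) b *: gpt P w j.
Proof.
apply: ev_inj => x; rewrite -ev_mul cas.1 ev_suml linear_sum.
by apply: eq_bigr => w _; rewrite evZl linearZ /= ev_gpt mulrC.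
Qed.

(** The functional a |-> \sum_(i, j) sigma_ij (a g_ji), with g the generic point
    acting on P.  The module P (x) P^* is projective along with P, and this element
    is what its splitting gives on the maps k -> P (x) P^* -> k, the second of
    which is the trace. *)
Definition integral : kG := \sum_i \sum_j (sigma i j *m lmul (gpt P j i) : 'rV_n).

Lemma ev_integral a : ev integral a = \sum_i \sum_j ev (sigma i j) (gpt P j i * a).
Proof.
rewrite ev_suml; apply: eq_bigr => i _; rewrite ev_suml.
by apply: eq_bigr => j _; rewrite ev_lmul.
Qed.

Lemma ev_integral1 : ev integral 1 = (mdim P)%:R.
Proof.
rewrite ev_integral exchange_big /=.
under eq_bigr => j _ do under eq_bigr => i _ do rewrite mulr1 ev_gpt.
under eq_bigr => j _ do rewrite cas.2 eqxx.
by rewrite sumr_const card_ord.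
Qed.

(** Left invariance.  Invertibility of the generic point rewrites the second copy
    of g as g^-1 (the first copy) times the coproduct of g; the homomorphism
    property of sigma then produces g, which cancels g^-1. *)
Lemma integralP a : ev2 integral (comul a) = ev integral a *: 1.
Proof.
transitivity (\sum_i \sum_j ev2 (sigma i j) (inj2 (gpt P j i) * comul a)).
  rewrite /ev2 /integral !linear_sum /=; apply: eq_bigr => i _.
  rewrite !linear_sum /=; apply: eq_bigr => j _.
  by rewrite -/(ev2 (sigma i j) _) ev2_inj2.
rewrite ev_integral scaler_suml; apply: eq_bigr => i _.
transitivity (\sum_j \sum_q \sum_w
    ev (sigma i w) (gpt P q i * a) *: (gpt P w j * gptV P j q)).
  apply: eq_bigr => j _.
  have /matrixP/(_ j i) := inj2_gpt P; rewrite [LHS]mxE [RHS]mxE => ->.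
  rewrite mulr_suml linear_sum; apply: eq_bigr => q _.
rewrite [map_mx inj1 _ _ _]mxE [map_mx comul _ _ _]mxE -mulrA /= ev2M -rmorphM.
  rewrite casimir_comul mulr_sumr; apply: eq_bigr => w _.
  by rewrite -scalerAr [gptV _ _ _ * _]mulrC.
rewrite exchange_big [RHS]scaler_suml; apply: eq_bigr => q _.
rewrite exchange_big (bigD1 q) //= [X in _ + X]big1 => [|w ne].
  rewrite -scaler_sumr addr0; congr (_ *: _).
  by have /matrixP/(_ q q) := gpt_mulV P; rewrite mxE [RHS]mxE eqxx.
rewrite -scaler_sumr; have /matrixP/(_ w q) := gpt_mulV P.
rewrite mxE [RHS]mxE (negPf ne) => ->.
by rewrite scaler0.
Qed.
End Integral.

Section Maschke.
Variable L : kG.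
Hypotheses (L_inv : forall a, ev2 L (comul a) = ev L a *: 1) (L1 : ev L 1 != 0).

Let scal (c : k) : coord := c *: 1.
Local Notation "A ^sc" := (map_mx scal A) (at level 2, format "A ^sc").

Let scalM m n q (A : 'M[k]_(m, n)) (B : 'M_(n, q)) : (A *m B)^sc = A^sc *m B^sc.
Proof.
apply/matrixP => i j; rewrite !mxE /scal scaler_suml; apply: eq_bigr => l _.
by rewrite !mxE -scalerAl mul1r scalerA.
Qed.

Let scal1 m : (1%:M : 'M[k]_m)^sc = 1%:M.
Proof.
apply/matrixP => i j; rewrite !mxE /scal.
by case: (i == j); rewrite ?scale1r ?scale0r.
Qed.

Lemma gpt_homP (M N : fdmod kG) (f : 'M_(mdim N, mdim M)) :
  is_hom f <-> f^sc *m gpt M = gpt N *m f^sc.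
Proof.
have E1 x i j : ev x ((f^sc *m gpt M) i j) = (f *m mact M x) i j.
  rewrite [X in ev x X]mxE linear_sum [RHS]mxE; apply: eq_bigr => l _ /=.
  by rewrite [f^sc _ _]mxE -scalerAl mul1r linearZ /= ev_gpt.
have E2 x i j : ev x ((gpt N *m f^sc) i j) = (mact N x *m f) i j.
  rewrite [X in ev x X]mxE linear_sum [RHS]mxE; apply: eq_bigr => l _ /=.
  by rewrite [f^sc _ _]mxE -scalerAr mulr1 linearZ /= ev_gpt mulrC.
split=> [hf|E x]; apply/matrixP => i j; last by rewrite -E1 -E2 E.
by apply: ev_inj => x; rewrite E1 E2 hf.
Qed.

Lemma gptV_hom (M N : fdmod kG) (f : 'M_(mdim N, mdim M)) :
  is_hom f -> f^sc *m gptV M = gptV N *m f^sc.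
Proof.
move=> /gpt_homP E; rewrite -[LHS]mul1mx -(gpt_Vmul N) -mulmxA (mulmxA (gpt N)).
by rewrite -E -!mulmxA gpt_mulV mulmx1.
Qed.

(** Averaging a linear retraction r0: the entries of g_M r0 g_N^-1 are elements of
    k[G], and evaluating the invariant functional L on them yields a matrix r
    with r = g_M r g_N^-1. *)
Lemma maschke : semisimple kG.
Proof.
move=> M N f hf fmono.
have [r0 r0f] : exists r0 : 'M_(mdim M, mdim N), r0 *m f = 1%:M.
  have /row_freeP [B fB] : row_free f^T.
    rewrite -kermx_eq0; apply/eqP/row_matrixP => i; rewrite row0.
    apply: trmx_inj; rewrite trmx0; apply: fmono.
    by apply: trmx_inj; rewrite trmx_mul trmxK -row_mul mulmx_ker trmx0 row0.
  by exists B^T; apply: trmx_inj; rewrite trmx_mul trmxK fB trmx1.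
pose Y := gpt M *m r0^sc *m gptV N.
pose r := map_mx (ev L) Y.
have rE : r^sc = gpt M *m r^sc *m gptV N.
  have : map_mx (ev2 L) (map_mx comul Y) = r^sc.
    by apply/matrixP => i j; rewrite !mxE L_inv.
  have -> : map_mx comul Y =
      map_mx inj1 (gpt M) *m map_mx inj2 Y *m map_mx inj1 (gptV N).
    have Er : map_mx comul r0^sc = map_mx inj2 r0^sc.
      by apply/matrixP => i j; rewrite !mxE comulZ rmorph1 /inj2 /scal tensZr.
    by rewrite /Y !map_mxM comul_gpt comul_gptV Er !mulmxA.
  move=> E; rewrite -[LHS]E {E}; apply/matrixP => i j.
  rewrite [LHS]mxE [X in ev2 L X]mxE [RHS]mxE linear_sum; apply: eq_bigr => l _ /=.
  rewrite [X in X * _]mxE mulr_suml [in RHS]mxE mulr_suml linear_sum.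
  apply: eq_bigr => q _ /=.
  rewrite [map_mx inj1 _ _ _]mxE [map_mx inj2 _ _ _]mxE [map_mx inj1 _ _ _]mxE.
  rewrite -mulrA ev2M [inj2 _ * _]mulrC ev2M /inj2 ev2_tens [r^sc _ _]mxE.
  by rewrite [r _ _]mxE /scal [gptV _ _ _ * _]mulrC mulrA.
have hr : is_hom r.
  by apply/gpt_homP; rewrite {1}rE -mulmxA gpt_Vmul mulmx1.
have rf : r *m f = (ev L 1)%:M.
  have Yf : Y *m f^sc = 1%:M.
    rewrite /Y -!mulmxA -(gptV_hom hf) (mulmxA _ f^sc) -scalM r0f scal1 mul1mx.
    exact: gpt_mulV.
  apply/matrixP => i j; transitivity (ev L ((Y *m f^sc) i j)); last first.
    by rewrite Yf !mxE; case: (i == j); rewrite ?linear0.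
  rewrite [RHS](congr1 (ev L) (mxE _ _ _ _)) mxE linear_sum; apply: eq_bigr => l _ /=.
  by rewrite [r _ _]mxE [f^sc _ _]mxE /scal -scalerAr mulr1 linearZ /= mulrC.
exists ((ev L 1)^-1 *: r) => [a|].
  by rewrite -scalemxAl hr scalemxAr.
by rewrite -scalemxAl rf scale_scalar_mx mulVf.
Qed.
End Maschke.

(** * Injective modules are projective *)

Section Transfer.
Variables (I : fdmod kG) (rho : 'I_(mdim I) -> 'I_(mdim I) -> kG).
Hypothesis coc : cocasimir rho.

Lemma cocasimir_comul i j b :
  ev1 (rho i j) (comul b) = \sum_w ev (rho w j) b *: gpt I i w.
Proof.
apply: ev_inj => x; rewrite -ev_mul1 coc.1 ev_suml linear_sum.
by apply: eq_bigr => w _; rewrite evZl linearZ /= ev_gpt mulrC.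
Qed.

(** The functional a |-> \sum_(u, l) rho_ul (g_iu g_lj S(a)).  In Sweedler
    notation the element \sum_t e_t (x) r_t of kG (x) End(I) given by rho becomes
    \sum_t S(e_t'') (x) e_t' r_t e_t'''. *)
Definition transfer i j : kG :=
  \sum_u \sum_l (rho u l *m lmul (gpt I i u * gpt I l j) *m gs_antipode G : 'rV_n).

Lemma ev_transfer i j a :
  ev (transfer i j) a = \sum_u \sum_l ev (rho u l) (gpt I i u * gpt I l j * antip a).
Proof.
rewrite ev_suml; apply: eq_bigr => u _; rewrite ev_suml.
by apply: eq_bigr => l _; rewrite -ev_lmul /ev -!mulmxA.
Qed.

Local Notation U := (regular_mod G).

(** The homomorphism property of rho, solved for the evaluation of rho. *)
Lemma cocasimir_eval u l b :
  ev (rho u l) b *: 1 = \sum_m gptV I u m * ev1 (rho m l) (comul b).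
Proof.
transitivity (\sum_w ev (rho w l) b *: (gptV I *m gpt I) u w).
  rewrite gpt_Vmul (bigD1 u) //= mxE eqxx big1 ?addr0 // => w ne.
  by rewrite mxE eq_sym (negPf ne) scaler0.
transitivity (\sum_w \sum_m ev (rho w l) b *: (gptV I u m * gpt I m w)).
  by apply: eq_bigr => w _; rewrite mxE scaler_sumr.
rewrite exchange_big; apply: eq_bigr => m _; rewrite cocasimir_comul mulr_sumr.
by apply: eq_bigr => w _; rewrite scalerAr.
Qed.

(** For fixed l, the sum over u contracts the coproduct of g_iu with the inverse
    matrix coming from [cocasimir_eval]: only g_iu in the first factor is left. *)
Let transfer_column i j s t l :
  \sum_u ev (rho u l) (gpt I i u * gpt I l j * gptV U s t) *: 1 =
  \sum_q \sum_v \sum_u gptV U s q *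
    (ev (rho u l) (gpt I i u * gpt I l v * gptV U q t) *: gpt I v j) :> coord.
Proof.
under eq_bigr do rewrite cocasimir_eval.
rewrite exchange_big /=.
transitivity (\sum_m ev1 (rho m l)
   (inj1 (gpt I i m) * comul (gpt I l j) * comul (gptV U s t))).
  apply: eq_bigr => m _.
  have /matrixP/(_ i m) := inj1_gpt I; rewrite [LHS]mxE [RHS]mxE => ->.
  rewrite -mulrA mulr_suml linear_sum; apply: eq_bigr => u _ /=.
  rewrite [map_mx inj2 _ _ _]mxE [map_mx comul _ _ _]mxE.
  by rewrite -ev1M; congr (ev1 _ _); rewrite !rmorphM /=; ring.
transitivity (\sum_m \sum_q \sum_v gptV U s q *
    (ev (rho m l) (gpt I i m * gpt I l v * gptV U q t) *: gpt I v j)); last first.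
  rewrite exchange_big; apply: eq_bigr => q _; exact: exchange_big.
apply: eq_bigr => m _.
have /matrixP/(_ s t) := comul_gptV U; rewrite [LHS]mxE [RHS]mxE => ->.
rewrite mulr_sumr linear_sum; apply: eq_bigr => q _ /=.
have /matrixP/(_ l j) := comul_gpt I; rewrite [LHS]mxE [RHS]mxE => ->.
rewrite mulr_sumr mulr_suml linear_sum; apply: eq_bigr => v _ /=.
rewrite [map_mx inj1 (gpt I) _ _]mxE [map_mx inj2 (gpt I) _ _]mxE.
rewrite [map_mx inj1 (gptV U) _ _]mxE [map_mx inj2 (gptV U) _ _]mxE.
rewrite [X in ev1 _ X](_ : _ = inj2 (gptV U s q) * (inj2 (gpt I v j) *
  inj1 (gpt I i m * gpt I l v * gptV U q t))); last by rewrite !rmorphM /=; ring.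
by rewrite !ev1M /inj1 ev1_tens; congr (_ * _); rewrite -scalerAr mulr1.
Qed.

(** The homomorphism property of [transfer], tested on the coefficients of the
    regular representation.  These span k[G], and on them the antipode is the
    inverse matrix, whose coproduct is known. *)
Lemma transfer_comul i j s t :
  ev (transfer i j) (gpt U s t) *: 1 =
  \sum_q \sum_v gptV U s q * (ev (transfer i v) (gpt U q t) *: gpt I v j) :> coord.
Proof.
have E v q r : ev (transfer i v) (gpt U q r) =
    \sum_l \sum_u ev (rho u l) (gpt I i u * gpt I l v * gptV U q r).
  rewrite ev_transfer exchange_big; do 2!apply: eq_bigr => ? _.
  by rewrite [gptV U q r]mxE.
rewrite E scaler_suml; under eq_bigr do rewrite scaler_suml transfer_column.
rewrite exchange_big; apply: eq_bigr => q _ /=.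
rewrite exchange_big; apply: eq_bigr => v _ /=.
rewrite E scaler_suml mulr_sumr; apply: eq_bigr => l _.
by rewrite scaler_suml mulr_sumr.
Qed.

Lemma reg_act_inj (x y : kG) : reg_act x = reg_act y -> x = y.
Proof.
have E (z : kG) : z = \row_i (reg_act z *m (1 : kG)^T) i 0.
  apply/matrixP => a b; rewrite (ord1 a) [RHS]mxE mxE -[in LHS](mulr1 z).
  rewrite [in LHS](ga_basisE 1) mulr_sumr summxE.
  by apply: eq_bigr => l _; rewrite -scalerAr !mxE mulrC.
by move=> xy; rewrite (E x) (E y) xy.
Qed.

Theorem cocasimir_casimir : casimir transfer.
Proof.
split=> [x i j|i j].
  apply: reg_act_inj; apply/matrixP => s t.
  rewrite linear_sum summxE reg_actM mxE.
  have E : \sum_r gpt U s r * (ev (transfer i j) (gpt U r t) *: 1) =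
           \sum_v ev (transfer i v) (gpt U s t) *: gpt I v j :> coord.
    under eq_bigr do rewrite transfer_comul mulr_sumr.
    pose X q := \sum_v ev (transfer i v) (gpt U q t) *: gpt I v j : coord.
    rewrite exchange_big; transitivity (\sum_q (gpt U *m gptV U) s q * X q).
      apply: eq_bigr => q _; rewrite [(_ *m _) s q]mxE mulr_suml.
      apply: eq_bigr => r _.
      by rewrite -mulrA -mulr_sumr.
    rewrite gpt_mulV (bigD1 s) //= mxE eqxx mul1r big1 ?addr0 // => q ne.
    by rewrite mxE eq_sym (negPf ne) mul0r.
  transitivity (\sum_r mact U x s r * mact U (transfer i j) r t) => //.
  transitivity (ev x (\sum_r gpt U s r * (ev (transfer i j) (gpt U r t) *: 1))).
    rewrite [RHS]linear_sum; apply: eq_bigr => r _ /=.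
    by rewrite -scalerAr mulr1 linearZ /= !ev_gpt mulrC.
  rewrite E [LHS]linear_sum; apply: eq_bigr => v _ /=.
  by rewrite linearZ /= !ev_gpt mulrC linearZ [RHS]mxE.
transitivity (\sum_u \sum_m ev (rho u m) (\sum_l gptV I i l * gpt I l u * gpt I m j)).
  under eq_bigr do rewrite -ev_gpt ev_transfer.
  rewrite exchange_big; apply: eq_bigr => u _; rewrite exchange_big.
  apply: eq_bigr => m _; rewrite linear_sum; apply: eq_bigr => l _ /=.
  by congr (ev _ _); rewrite [gptV I i l]mxE; ring.
rewrite (bigD1 i) //= [X in _ + X]big1 ?addr0 => [|u ne].
  rewrite -coc.2; apply: eq_bigr => m _; rewrite -mulr_suml -ev_gpt.
  have /matrixP/(_ i i) := gpt_Vmul I.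
  by rewrite [LHS]mxE [RHS]mxE eqxx => ->; rewrite mul1r.
rewrite big1 // => m _; rewrite -mulr_suml.
have /matrixP/(_ i u) := gpt_Vmul I.
by rewrite [LHS]mxE [RHS]mxE eq_sym (negPf ne) => ->; rewrite mul0r linear0.
Qed.
End Transfer.

End Coord.

(** * Splitting free and cofree modules *)

Section FreeCofree.
Variables (k : fieldType) (G : finGroupScheme k).
Local Notation kG := (group_algebra G).
Local Notation n := (gsdim G).
Variable M : fdmod kG.
Local Notation m := (mdim M).

Lemma ga_sum_entry I (s : seq I) (F : I -> kG) i :
  ((\sum_(l <- s) F l : kG) : 'rV_n) 0 i = \sum_(l <- s) (F l : 'rV_n) 0 i.
Proof. exact: summxE. Qed.

Lemma ga_linE c (x y : kG) i :
  ((c *: x + y : kG) : 'rV_n) 0 i = c * (x : 'rV_n) 0 i + (y : 'rV_n) 0 i.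
Proof. by rewrite !mxE. Qed.

Lemma reg_actE (x : kG) i j : reg_act x i j = (x * ga_basis j : 'rV_n) 0 i.
Proof. by rewrite mxE. Qed.

(** kG (x) M, where kG acts on the left factor only. *)
Definition free_act (x : kG) : 'M[k]_(n * m) := reg_act x *t (1%:M : 'M_m).
Fact free_act_is_linear : linear free_act.
Proof.
by move=> c x y; apply/matrixP => i j; rewrite /free_act linearP !mxE mulrDl mulrA.
Qed.
HB.instance Definition _ :=
  GRing.isLinear.Build k kG 'M[k]_(n * m) _ free_act free_act_is_linear.
Lemma tens11 p q : (1%:M : 'M[k]_p) *t (1%:M : 'M_q) = 1%:M.
Proof.
apply/matrixP => i j; case: (mxtens_indexP i) => a b; case: (mxtens_indexP j) => c d.
rewrite tensmxE !mxE (can_eq (@mxtens_indexK _ _)) -pair_eqE /pair_eq /=.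
by rewrite -natrM mulnb.
Qed.
Fact free_act1 : free_act 1 = 1%:M.
Proof. by rewrite /free_act reg_act1 tens11. Qed.
Fact free_actM x y : free_act (x * y) = free_act x *m free_act y.
Proof. by rewrite /free_act reg_actM tensmx_mul mulmx1. Qed.
Definition free_mod : fdmod kG := FdMod free_act1 free_actM.

(** Hom_k(kG, M) = k[G] (x) M, where x acts by right translation of functions;
    [right_mul] is its matrix on k[G]. *)
Definition right_mul (x : kG) : 'M[k]_n :=
  \matrix_(s, t) (ga_basis s * x : 'rV_n) 0 t.
Lemma right_mulE x s t : right_mul x s t = (ga_basis s * x : 'rV_n) 0 t.
Proof. by rewrite mxE. Qed.
Fact right_mul_is_linear : linear right_mul.
Proof.
move=> c x y; apply/matrixP => s t; rewrite [RHS]mxE [X in _ = X + _]mxE.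
by rewrite !right_mulE mulrDr -scalerAr ga_linE.
Qed.
HB.instance Definition _ :=
  GRing.isLinear.Build k kG 'M[k]_n _ right_mul right_mul_is_linear.
Definition cofree_act (x : kG) : 'M[k]_(n * m) := right_mul x *t (1%:M : 'M_m).
Fact cofree_act_is_linear : linear cofree_act.
Proof.
by move=> c x y; apply/matrixP => i j; rewrite /cofree_act linearP !mxE mulrDl mulrA.
Qed.
HB.instance Definition _ :=
  GRing.isLinear.Build k kG 'M[k]_(n * m) _ cofree_act cofree_act_is_linear.
Fact cofree_act1 : cofree_act 1 = 1%:M.
Proof.
rewrite /cofree_act (_ : right_mul 1 = 1%:M) ?tens11 //.
by apply/matrixP => s t; rewrite right_mulE mulr1 !mxE eqxx eq_sym.
Qed.
Fact cofree_actM x y : cofree_act (x * y) = cofree_act x *m cofree_act y.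
Proof.
rewrite /cofree_act tensmx_mul mulmx1; congr (_ *t _).
apply/matrixP => s t; rewrite right_mulE [RHS]mxE mulrA.
rewrite (ga_basisE (ga_basis s * x)) mulr_suml ga_sum_entry; apply: eq_bigr => l _.
by rewrite !right_mulE -scalerAl [LHS]mxE.
Qed.
Definition cofree_mod : fdmod kG := FdMod cofree_act1 cofree_actM.

Lemma projective_casimir : projective M ->
  exists sigma : 'I_m -> 'I_m -> kG, casimir sigma.
Proof.
move=> projM.
pose q : 'M[k]_(m, n * m) :=
  \matrix_(i, tj) mact M (ga_basis (mxtens_unindex tj).1) i (mxtens_unindex tj).2.
have qE (x : kG) j i :
    \sum_t (x : 'rV_n) 0 t * q i (mxtens_index (t, j)) = mact M x i j.
  rewrite [in RHS](ga_basisE x) linear_sum summxE; apply: eq_bigr => t _.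
  by rewrite linearZ !mxE mxtens_indexK.
have hq : @is_hom _ _ free_mod M q.
  move=> x; apply/matrixP => i tj; case: (mxtens_indexP tj) => t j.
  rewrite mxE sum_mxtens.
  transitivity (mact M (x * ga_basis t) i j).
    rewrite -qE; apply: eq_bigr => s _; rewrite (bigD1 j) //= big1 => [|l ne].
      by rewrite /free_act tensmxE [1%:M _ _]mxE eqxx mulr1 addr0 reg_actE mulrC.
    by rewrite /free_act tensmxE [1%:M _ _]mxE (negPf ne) !mulr0.
  by rewrite mactM mxE [RHS]mxE; apply: eq_bigr => l _; rewrite mxE mxtens_indexK.
have [|h hh qh] := projM free_mod M q 1%:M hq _ (@hom_id _ _ M).
  move=> w; exists ((1 : kG)^T *t w).
  apply/matrixP => i z; rewrite (ord1 z) mxE sum_mxtens exchange_big /=.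
  transitivity (\sum_j mact M 1 i j * w j 0).
    apply: eq_bigr => j _; rewrite -qE mulr_suml; apply: eq_bigr => t _.
    rewrite [X in _ * X]mxE !mxtens_indexK /= [_^T _ _]mxE.
    by rewrite !(ord1 (Ordinal _)) mulrA; congr (_ * _); rewrite mulrC.
  have := mul1mx w; rewrite -(mact1 M) => /matrixP/(_ i 0); rewrite mxE; exact.
pose sigma i j : kG := \row_t h (mxtens_index (t, i)) j.
exists sigma; split=> [x i j|i j].
  apply/matrixP => z t; rewrite (ord1 z) ga_sum_entry.
  have /matrixP/(_ (mxtens_index (t, i)) j) := hh x; rewrite mxE => E.
  transitivity (\sum_w h (mxtens_index (t, i)) w * mact M x w j); last first.
    by apply: eq_bigr => w _; rewrite !mxE mulrC.
  rewrite E [RHS]mxE sum_mxtens.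
  rewrite (ga_basisE (sigma i j)) mulr_sumr ga_sum_entry; apply: eq_bigr => s _.
  rewrite (bigD1 i) //= big1 => [|l ne].
    rewrite addr0 /free_act tensmxE [1%:M _ _]mxE eqxx mulr1 reg_actE.
    by rewrite -scalerAr !mxE mulrC.
  by rewrite /free_act tensmxE [1%:M _ _]mxE eq_sym (negPf ne) mulr0 mul0r.
have /matrixP/(_ i j) := qh; rewrite mxE sum_mxtens exchange_big [RHS]mxE => <-.
apply: eq_bigr => l _; rewrite -qE; apply: eq_bigr => t _.
by rewrite mxE mulrC.
Qed.

Lemma injective_cocasimir : Defs.injective M ->
  exists rho : 'I_m -> 'I_m -> kG, cocasimir rho.
Proof.
move=> injM.
pose q : 'M[k]_(n * m, m) :=
  \matrix_(ti, j) mact M (ga_basis (mxtens_unindex ti).1) (mxtens_unindex ti).2 j.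
have qE (x : kG) j i :
    \sum_t (x : 'rV_n) 0 t * q (mxtens_index (t, i)) j = mact M x i j.
  rewrite [in RHS](ga_basisE x) linear_sum summxE; apply: eq_bigr => t _.
  by rewrite linearZ !mxE mxtens_indexK.
have hq : @is_hom _ _ M cofree_mod q.
  move=> x; apply/matrixP => ti j; case: (mxtens_indexP ti) => t i.
  rewrite [RHS]mxE sum_mxtens.
  transitivity (mact M (ga_basis t * x) i j).
    by rewrite mactM mxE [RHS]mxE; apply: eq_bigr => l _; rewrite mxE mxtens_indexK.
  rewrite -qE; apply: eq_bigr => s _; rewrite (bigD1 i) //= big1 => [|l ne].
    by rewrite /cofree_act tensmxE [1%:M _ _]mxE eqxx mulr1 addr0 right_mulE.
  by rewrite /cofree_act tensmxE [1%:M _ _]mxE eq_sym (negPf ne) mulr0 mul0r.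
have [|h hh qh] := injM M cofree_mod q 1%:M hq _ (@hom_id _ _ M).
  move=> w qw; rewrite -[w]mul1mx -(mact1 M); apply/matrixP => i z.
  rewrite mxE; transitivity (\sum_t (1 : kG) 0 t * (q *m w) (mxtens_index (t, i)) z).
    under [RHS]eq_bigr do rewrite mxE mulr_sumr.
    rewrite exchange_big; apply: eq_bigr => j _; rewrite -qE mulr_suml.
    by apply: eq_bigr => t _; rewrite mulrA.
  by rewrite qw big1 ?mxE // => t _; rewrite mxE mulr0.
pose rho i j : kG := \row_t h i (mxtens_index (t, j)).
exists rho; split=> [x i j|i j].
  apply/matrixP => z t; rewrite (ord1 z) ga_sum_entry.
  have /matrixP/(_ i (mxtens_index (t, j))) := hh x; rewrite [RHS]mxE => E.
  transitivity (\sum_w mact M x i w * h w (mxtens_index (t, j))); last first.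
    by apply: eq_bigr => w _; rewrite !mxE.
  rewrite -E [RHS]mxE sum_mxtens.
  rewrite (ga_basisE (rho i j)) mulr_suml ga_sum_entry; apply: eq_bigr => s _.
  rewrite (bigD1 j) //= big1 => [|l ne].
    rewrite addr0 /cofree_act tensmxE [1%:M _ _]mxE eqxx mulr1 right_mulE.
    by rewrite -scalerAl !mxE.
  by rewrite /cofree_act tensmxE [1%:M _ _]mxE (negPf ne) !mulr0.
have /matrixP/(_ i j) := qh; rewrite mxE sum_mxtens exchange_big [RHS]mxE => <-.
apply: eq_bigr => l _; rewrite -qE; apply: eq_bigr => t _.
by rewrite mxE.
Qed.
End FreeCofree.

(** * Flat maps from K[t]/t^p *)

Section FreeAlong.
Variables (k : fieldType) (G : finGroupScheme k) (p : nat).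
Local Notation kG := (group_algebra G).
Local Notation n := (gsdim G).

Lemma reg_act_tr (x y : kG) : reg_act x *m (y : 'rV_n)^T = (x * y : 'rV_n)^T.
Proof.
apply/matrixP => i z; rewrite (ord1 z) mxE [RHS]mxE (ga_basisE y) mulr_sumr.
rewrite ga_sum_entry; apply: eq_bigr => l _.
by rewrite reg_actE -scalerAr [RHS]mxE mulrC [_^T _ _]mxE -ga_basisE.
Qed.

(** Embed P in kG (x) P by sigma.  If X^(p-1) v = 0, the coordinates y_i of the
    image of v are killed by x^(p-1), hence lie in x kG; applying the action map
    brings v back, as an element of X P. *)
Lemma casimir_nilfree (P : fdmod kG) (sigma : 'I_(mdim P) -> 'I_(mdim P) -> kG) x :
  casimir sigma -> nilfree p (mact (regular_mod G) x) -> nilfree p (mact P x).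
Proof.
move=> cas [xp xfree]; split.
  rewrite -mactX; suff -> : x ^+ p = 0 by rewrite linear0.
  apply: reg_act_inj; rewrite linear0 -[LHS]/(mact (regular_mod G) (x ^+ p)).
  by rewrite mactX xp.
move=> v; rewrite -mactX => xv.
pose y i : kG := \sum_j v j 0 *: sigma i j.
have yw i : exists w : kG, y i = x * w.
  have [|w yw] := xfree (y i : 'rV_n)^T.
    rewrite -mactX [_ *m _]reg_act_tr.
    suff -> : x ^+ p.-1 * y i = 0 by exact: trmx0.
    transitivity (\sum_w (mact P (x ^+ p.-1) *m v) w 0 *: sigma i w); last first.
      by rewrite xv big1 // => w _; rewrite mxE scale0r.
    transitivity (\sum_j \sum_w (mact P (x ^+ p.-1) w j * v j 0) *: sigma i w).
      rewrite mulr_sumr; apply: eq_bigr => j _; rewrite -scalerAr cas.1 scaler_sumr.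
      by apply: eq_bigr => w _; rewrite scalerA mulrC.
    by rewrite exchange_big; apply: eq_bigr => w _; rewrite mxE scaler_suml.
  exists (w^T : 'rV_n); apply: trmx_inj; rewrite yw.
  by rewrite -(reg_act_tr x (w^T : 'rV_n)) trmxK.
have [w yE] := fin_all_exists yw.
exists (\sum_i mact P (w i) *m delta_mx i 0); apply/matrixP => a z; rewrite (ord1 z).
transitivity (\sum_i mact P (y i) a i).
  transitivity (\sum_j v j 0 * (a == j)%:R).
    rewrite (bigD1 a) //= eqxx mulr1 big1 ?addr0 // => j ne.
    by rewrite eq_sym (negPf ne) mulr0.
  transitivity (\sum_j \sum_i v j 0 * mact P (sigma i j) a i).
    by apply: eq_bigr => j _; rewrite -cas.2 mulr_sumr.
  rewrite exchange_big; apply: eq_bigr => i _; rewrite linear_sum summxE.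
  by apply: eq_bigr => j _; rewrite linearZ [RHS]mxE.
rewrite mulmx_sumr summxE; apply: eq_bigr => i _.
by rewrite yE mactM mulmxA -colE [RHS]mxE.
Qed.
End FreeAlong.

Section Flat.
Variables (K : fieldType) (p : nat).
Hypothesis p_gt0 : (0 < p)%N.
Local Notation R := (trunc_poly K p).
Local Notation t := (tvar K p).

Lemma trunc_const (a : R) : exists b : R, a = (a : {poly K})`_0 *: 1 + t * b.
Proof.
case sz : (size (a : {poly K})) (trunc_sum a) => [|s] aE.
  exists 0; rewrite mulr0 addr0 {1}aE big_ord0.
  by rewrite nth_default ?scale0r // sz.
exists (\sum_(i < s) (a : {poly K})`_i.+1 *: t ^+ i).
rewrite {1}aE big_ord_recl expr0; congr (_ + _); rewrite mulr_sumr.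
by apply: eq_bigr => i _; rewrite -scalerAr -exprS.
Qed.

(** Flatness is applied to the socle inclusion K -> K[t]/t^p, 1 |-> t^(p-1).  If
    X^(p-1) v = 0 then 1 (x) v dies in K[t]/t^p (x) L = L, so it is zero in
    K (x) L = L / X L. *)
Lemma flat_nilfree (L : fdmod R) : flat L -> nilfree p (mact L t).
Proof.
move=> flatL; split=> [|v]; first exact: mact_nilp.
rewrite -mactX => Xv.
have lt_p1 : (p.-1 < p)%N by rewrite prednK.
pose J0 := jblock K (Ordinal p_gt0); pose J1 := jblock K (Ordinal lt_p1).
pose f : 'M[K]_(mdim J1, mdim J0) := delta_mx ord_max ord0.
have J1X j c : mact J1 (t ^+ j) *m delta_mx c 0
    = \col_r (val r == c + j)%N%:R :> 'cV_(mdim J1).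
  by apply/matrixP => r z; rewrite (ord1 z) -colE mxE [RHS]mxE jblock_tX.
have hf : @is_hom _ _ J0 J1 f.
  apply/trunc_homP/matrixP => r c; rewrite !mxE.
  rewrite big_ord1 big1 => [|l _].
    by rewrite -[t]expr1 jblock_tX //= (ord1 c) mulr0.
  rewrite -[t]expr1 jblock_tX // mxE.
  have [->|ne] := eqVneq l ord_max; last by rewrite mulr0.
  by rewrite [_ == _ :> nat](_ : _ = false) ?mul0r //= ltn_eqF // addn1 ltn_ord.
have fmono : mono f.
  move=> u fu; apply/matrixP => i z; rewrite (ord1 z) (ord1 i).
  have /matrixP/(_ ord_max 0) := fu; rewrite mxE big_ord1 !mxE !eqxx mul1r.
  by rewrite [ord0](ord1 _).
pose w : 'cV[K]_(mdim J0 * mdim L) := (const_mx 1 : 'cV_(mdim J0)) *t v.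
have bal : @balancing K R J1 L ((f *t 1%:M) *m w).
  exists [:: ((delta_mx ord0 0 : 'cV_(mdim J1)), t ^+ p.-1, v)].
  rewrite big_seq1 /= Xv tensmx0 subr0 (J1X _ ord0).
  transitivity ((f *m const_mx 1 : 'cV_(mdim J1)) *t ((1%:M : 'M_(mdim L)) *m v)).
    by have E := tensmx_mul f (1%:M : 'M_(mdim L)) (const_mx 1 : 'cV_(mdim J0)) v.
  rewrite mul1mx [X in X *t _](_ : _ = \col_r
    (val r == (ord0 : 'I_(mdim J1)) + p.-1)%N%:R :> 'cV_(mdim J1)) //.
  apply/matrixP => r z; rewrite (ord1 z) !mxE big_ord1 !mxE eqxx andbT mulr1.
  by rewrite -val_eqE.
have [s ws] := flatL _ _ _ hf fmono _ bal.
pose phi (W : 'cV[K]_(mdim J0 * mdim L)) : 'cV_(mdim L) :=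
  \col_i W (mxtens_index (ord0, i)) 0.
have phit (x : 'cV_(mdim J0)) (y : 'cV_(mdim L)) : phi (x *t y) = x ord0 0 *: y.
  apply/matrixP => i z; rewrite (ord1 z) !mxE !mxtens_indexK /=.
  by rewrite !(ord1 (Ordinal _)).
have phiD W W' : phi (W + W') = phi W + phi W'.
  by apply/matrixP => i z; rewrite !mxE.
have phiN W : phi (- W) = - phi W.
  by apply/matrixP => i z; rewrite !mxE.
have -> : v = phi w by rewrite phit mxE scale1r.
rewrite ws; elim: s {ws} => [|[[x a] y] s [u IH]].
  by exists 0; rewrite mulmx0 big_nil; apply/matrixP => i z; rewrite !mxE.
have [b ab] := trunc_const a.
have La : mact L a = (a : {poly K})`_0 *: 1%:M + mact L t *m mact L b.
  by rewrite {1}ab linearP mact1 mactM.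
exists (- (x ord0 0 *: (mact L b *m y)) + u); rewrite mulmxDr -IH big_cons /=.
rewrite phiD; congr (_ + _); rewrite phiD phiN !phit.
have J0a : jblock_act (Ordinal p_gt0) a ord0 ord0 = (a : {poly K})`_0 by rewrite mxE.
rewrite La mxE big_ord1 J0a.
rewrite mulmxDl scalerDr opprD addrA -scalemxAl mul1mx scalerA mulrC subrr sub0r.
by rewrite mulmxN -scalemxAr mulmxA.
Qed.
End Flat.

(** * Extension of scalars *)

Section BaseChangeModules.
Variables (k K : fieldType) (s : {rmorphism k -> K}) (G : finGroupScheme k).
Local Notation kG := (group_algebra G).
Local Notation KG := (group_algebra (base_change s G)).
Local Notation n := (gsdim G).
Implicit Types M N : fdmod kG.

Definition bc_ga (x : kG) : KG := map_mx s (x : 'rV_n).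

Lemma bc_ga_span (x : KG) : x = \sum_i (x : 'rV_n) 0 i *: bc_ga (ga_basis i).
Proof.
rewrite {1}[x](row_sum_delta (x : 'rV[K]_n)); apply: eq_bigr => i _.
by rewrite /bc_ga map_delta_mx.
Qed.

Lemma bc_gaM (x y : kG) : bc_ga (x * y) = bc_ga x * bc_ga y.
Proof.
rewrite /bc_ga [in RHS]/GRing.mul /= /ga_mul /= map_mxM; congr (_ *m _).
by rewrite -map_mxT.
Qed.

Lemma bc_act_ga M (x : kG) :
  mact (base_change_mod s M) (bc_ga x) = map_mx s (mact M x).
Proof.
rewrite [in RHS](ga_basisE x) linear_sum map_mx_sum; apply: eq_bigr => i _.
by rewrite linearZ map_mxZ mxE.
Qed.

Lemma bc_hom M N (f : 'M_(mdim N, mdim M)) : is_hom f ->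
  @is_hom _ _ (base_change_mod s M) (base_change_mod s N) (map_mx s f).
Proof.
move=> hf x; rewrite /= /bc_act mulmx_sumr mulmx_suml; apply: eq_bigr => i _.
by rewrite -scalemxAr -scalemxAl -!map_mxM hf.
Qed.

Lemma bc_iso M N : mod_iso M N -> mod_iso (base_change_mod s M) (base_change_mod s N).
Proof.
case=> f [g [hf hg fg gf]]; exists (map_mx s f), (map_mx s g).
by split; [exact: bc_hom | exact: bc_hom | |]; rewrite -map_mxM ?fg ?gf map_mx1.
Qed.

Lemma bc_casimir M (sigma : 'I_(mdim M) -> 'I_(mdim M) -> kG) :
  casimir sigma -> @casimir _ _ (base_change_mod s M) (fun i j => bc_ga (sigma i j)).
Proof.
move=> cas; split=> [x i j|i j]; last first.
  transitivity (s (\sum_l mact M (sigma l j) i l)).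
    by rewrite rmorph_sum; apply: eq_bigr => l _; rewrite bc_act_ga mxE.
  by rewrite cas.2 rmorph_nat.
rewrite (bc_ga_span x) mulr_suml.
transitivity (\sum_t (x : 'rV_n) 0 t *:
   \sum_w mact (base_change_mod s M) (bc_ga (ga_basis t)) w j *: bc_ga (sigma i w)).
  apply: eq_bigr => t _; rewrite -scalerAl -bc_gaM cas.1; congr (_ *: _).
  rewrite /bc_ga map_mx_sum; apply: eq_bigr => w _.
  by rewrite [in LHS]map_mxZ -/(bc_ga _) bc_act_ga mxE.
under eq_bigr do rewrite scaler_sumr.
rewrite exchange_big; apply: eq_bigr => w _; rewrite -(bc_ga_span x).
have -> : mact (base_change_mod s M) x w j = \sum_t (x : 'rV_n) 0 t *
    mact (base_change_mod s M) (bc_ga (ga_basis t)) w j.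
  rewrite [in LHS](bc_ga_span x) linear_sum summxE; apply: eq_bigr => t _.
  by rewrite linearZ [LHS]mxE.
by rewrite scaler_suml; apply: eq_bigr => t _; rewrite scalerA.
Qed.

Lemma bc_exact L M N (f : 'M_(mdim M, mdim L)) (g : 'M_(mdim N, mdim M)) :
  short_exact f g ->
  [/\ \rank (map_mx s f) = mdim L, \rank (map_mx s g) = mdim N
    & exact_at (map_mx s f) (map_mx s g)].
Proof.
case=> hf hg fmono gepi ex.
have rkf : \rank f = mdim L.
  have e : exact_at (0 : 'M[k]_(mdim L)) f.
    move=> v; split=> [/fmono ->|[w ->]]; last by rewrite mul0mx mulmx0.
    by exists 0; rewrite mulmx0.
  by have := exact_rank e; rewrite mxrank0.
have rkg : \rank g = mdim N.
  have e : exact_at g (0 : 'M[k]_(mdim N)).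
    move=> v; split=> [_|_]; last exact: mul0mx.
    by have [w gw] := gepi v; exists w.
  by have := exact_rank e; rewrite mxrank0 addn0.
split; rewrite ?mxrank_map //.
have gf : g *m f = 0.
  apply/matrixP => i j; have [_] := ex (f *m delta_mx j 0).
  move=> /(_ (ex_intro _ _ erefl)) /matrixP /(_ i 0).
  by rewrite mulmxA -colE !mxE.
apply: rank_exactP; first by rewrite -map_mxM gf map_mx0.
by rewrite !mxrank_map (exact_rank ex).
Qed.
End BaseChangeModules.

(** * Ranks along pi-points *)

Section Ranks.
Variables (k : fieldType) (p : nat) (G : finGroupScheme k).
Hypothesis p_gt0 : (0 < p)%N.
Local Notation kG := (group_algebra G).
Implicit Types (M N L P : fdmod kG) (alpha : pi_point p G).

Definition pi_restriction alpha M :=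
  restriction (pp_map alpha) (base_change_mod (pp_ext alpha) M).

Definition pi_rank alpha M j :=
  \rank (mact (pi_restriction alpha M) (tvar _ p) ^+ j).

Lemma constant_rankP M a :
  has_constant_jordan_type M a <->
  forall alpha j, pi_rank alpha M j = (\sum_(i < p) a i * (i.+1 - j))%N.
Proof.
split=> [Ma alpha j|Ma alpha]; first by have /jordan_typeP := Ma alpha; apply.
by apply/jordan_typeP => // j; apply: Ma.
Qed.

Lemma constant_rank M (r : nat -> nat) :
  (forall alpha j, pi_rank alpha M j = r j) -> constant_jordan_type p M.
Proof.
move=> Mr; exists [ffun i : 'I_p => r i + r i.+2 - (r i.+1).*2]%N => alpha.
have [b ib] := jordan_exists p_gt0 (pi_restriction alpha M).
rewrite [X in has_jordan_type _ X](_ : _ = b) //; apply/ffunP => i; rewrite ffunE.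
have /(jordan_typeP p_gt0) rb := ib.
by rewrite -!(Mr alpha) /pi_rank !rb second_difference addnK.
Qed.

Lemma pi_rank0 alpha M : pi_rank alpha M 0 = mdim M.
Proof. exact: mxrank1. Qed.

Lemma pi_rank_ge alpha M j : (p <= j)%N -> pi_rank alpha M j = 0%N.
Proof.
move=> le_pj; rewrite /pi_rank -(subnK le_pj) mxXD mact_nilp //.
by rewrite mulmx0 mxrank0.
Qed.

Lemma pi_rank_iso alpha M N j : mod_iso M N -> pi_rank alpha M j = pi_rank alpha N j.
Proof.
move=> MN; rewrite /pi_rank -!mactX.
exact: (iso_rank (pp_map alpha (tvar _ p ^+ j)) (bc_iso (pp_ext alpha) MN)).
Qed.

Lemma pi_rank_dsum alpha M N j :
  pi_rank alpha (dsum M N) j = (pi_rank alpha M j + pi_rank alpha N j)%N.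
Proof.
set s := pp_ext alpha.
have iso : mod_iso (base_change_mod s (dsum M N))
                   (dsum (base_change_mod s M) (base_change_mod s N)).
  apply: (@biproduct_iso _ _ (base_change_mod s M) (base_change_mod s N)
    (base_change_mod s (dsum M N)) (map_mx s (in1 M N)) (map_mx s (in2 M N))
    (map_mx s (pr1 M N)) (map_mx s (pr2 M N))).
  - exact/bc_hom/hom_in1.
  - exact/bc_hom/hom_in2.
  - exact/bc_hom/hom_pr1.
  - exact/bc_hom/hom_pr2.
  - by rewrite -map_mxM pr1_in1 map_mx1.
  - by rewrite -map_mxM pr2_in2 map_mx1.
  - by rewrite -map_mxM pr1_in2 map_mx0.
  - by rewrite -map_mxM pr2_in1 map_mx0.
  - by rewrite -!map_mxM -map_mxD dsum_id map_mx1.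
rewrite /pi_rank -!mactX.
apply: etrans (iso_rank (pp_map alpha (tvar _ p ^+ j)) iso) _.
exact: rank_diag_block_mx.
Qed.

(** Flatness gives freeness of KG, and the family carries it over to P. *)
Lemma casimir_free alpha P (sigma : 'I_(mdim P) -> 'I_(mdim P) -> kG) :
  casimir sigma -> nilfree p (mact (pi_restriction alpha P) (tvar _ p)).
Proof.
move=> cas.
have fr := flat_nilfree p_gt0 (@pp_flat _ _ _ alpha).
have casK := bc_casimir (pp_ext alpha) cas.
exact: (casimir_nilfree (x := pp_map alpha (tvar _ p)) casK fr).
Qed.

Lemma casimir_rank alpha P (sigma : 'I_(mdim P) -> 'I_(mdim P) -> kG) j :
  casimir sigma -> (j <= p)%N ->
  (p %| mdim P)%N /\ pi_rank alpha P j = ((p - j) * (mdim P %/ p))%N.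
Proof. by move=> /casimir_free/nilfree_rank; apply. Qed.

Lemma short_exact_rank alpha L P N (f : 'M_(mdim P, mdim L)) (g : 'M_(mdim N, mdim P))
    (sigma : 'I_(mdim P) -> 'I_(mdim P) -> kG) j :
  casimir sigma -> short_exact f g -> (j <= p)%N ->
  (pi_rank alpha L j + mdim N =
   pi_rank alpha N (p - j) + (p - j) * (mdim P %/ p))%N.
Proof.
move=> cas ex le_jp; rewrite -(casimir_rank alpha cas le_jp).2.
have [rkf rkg exK] := bc_exact (pp_ext alpha) ex.
have [hf hg _ _ _] := ex.
have hfK := bc_hom (s := pp_ext alpha) hf; have hgK := bc_hom (s := pp_ext alpha) hg.
apply: (exact_rank_shift rkf rkg exK _ _ (casimir_free alpha cas) le_jp).
  exact: hfK.
exact: hgK.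
Qed.

(** The relation between the ranks on M and on a Heller shift of M.  At j = 0 it
    reads dim L + dim M = p d, so it is symmetric in M and L: replace j by p - j. *)
Definition rank_shift M L := exists d, forall alpha j, (j <= p)%N ->
  (pi_rank alpha L j + mdim M = pi_rank alpha M (p - j) + (p - j) * d)%N.

Lemma Omega_rank M L : is_Omega M L -> rank_shift M L.
Proof.
case=> P [i [q [[projP _ _ _] ex]]].
have [sigma cas] := projective_casimir projP.
by exists (mdim P %/ p)%N => alpha j; apply: short_exact_rank cas ex.
Qed.

(** The sequence M -> I -> L has the roles of M and L exchanged. *)
Lemma Omega_inv_rank M L : is_Omega_inv M L -> rank_shift M L.
Proof.
case=> I [i [q [[injI _ _ _] ex]]].
have [rho /cocasimir_casimir cas] := injective_cocasimir injI.
exists (mdim I %/ p)%N => alpha j le_jp.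
have := short_exact_rank alpha cas ex (leq_subr j p); rewrite subKn //.
have := short_exact_rank alpha cas ex (leq0n p).
rewrite pi_rank0 subn0 pi_rank_ge // add0n => eL eM.
move: le_jp eL eM; move: (pi_rank _ _ _) (pi_rank _ _ _) (mdim I %/ p)%N => a b d.
move: (mdim M) (mdim L) => m l le_jp.
have -> : (p * d = (p - j) * d + j * d)%N by rewrite -mulnDl subnK.
lia.
Qed.

(** Omega and its inverse shift ranks in the same way, so one induction serves
    shifts of either sign. *)
Lemma Heller_ind (Q : nat -> fdmod kG -> Prop) M :
  Q 0%N M -> (forall n N L, mod_iso N L -> Q n N -> Q n L) ->
  (forall n N L, rank_shift N L -> Q n N -> Q n.+1 L) ->
  forall i L, is_Heller_shift i M L -> Q `|i|%N L.
Proof.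
move=> Q0 Qiso Qstep.
have iterQ R : (forall N L, R N L -> rank_shift N L) ->
    forall n L, iter_rel R n M L -> Q n L.
  move=> Rs; elim=> [|n IH] L /=; first by move/Qiso; apply.
  by case=> N /IH QN /Rs/Qstep; apply.
by case=> n L; apply: iterQ; [exact: Omega_rank | exact: Omega_inv_rank].
Qed.

Lemma constant_shift M L : rank_shift M L ->
  constant_jordan_type p M -> constant_jordan_type p L.
Proof.
case=> d sh [a /constant_rankP Ma].
pose r j := (\sum_(i < p) a i * (i.+1 - j))%N.
apply: (@constant_rank _ (fun j =>
  if (j <= p)%N then r (p - j) + (p - j) * d - mdim M else 0)%N).
move=> alpha j; case: leqP => [le_jp|/ltnW/pi_rank_ge -> //].
by rewrite /r -(Ma alpha) -sh // addnK.
Qed.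

(** Along each pi-point, M is a free module plus one block of size q. *)
Definition stable_block q M := forall alpha, exists n, forall j, (j <= p)%N ->
  pi_rank alpha M j = (n * (p - j) + (q - j))%N.

(** The number of free summands is forced by dim M, which makes it independent
    of the pi-point. *)
Lemma stable_block_type q M : (0 < q <= p)%N -> stable_block q M ->
  exists n, has_constant_jordan_type M (jt p p *+ n + jt p q).
Proof.
move=> hq Mq; exists ((mdim M - q) %/ p)%N; apply/constant_rankP => alpha j.
have pp : (0 < p <= p)%N by rewrite p_gt0 leqnn.
transitivity ((mdim M - q) %/ p * (p - j) + (q - j))%N; last first.
  rewrite -(jt_rank j hq) -(jt_rankMn _ _ pp) -big_split; apply: eq_bigr => i _.
  by rewrite [in RHS]ffunE mulnDl.
have [n Mn] := Mq alpha.
have := Mn 0%N isT; rewrite pi_rank0 !subn0 => ->; rewrite addnK mulnK //.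
have [/Mn //|lt_pj] := leqP j p.
rewrite pi_rank_ge ?(ltnW lt_pj) //; lia.
Qed.

(** The count for Omega: covering the n + 1 blocks of M takes n + 1 of the d free
    generators, the block of size q leaves a block of size p - q in the kernel,
    and the other d - n - 1 generators stay as free summands.  The inverse of
    Omega obeys the same relation of ranks. *)
Lemma stable_block_shift q M L : (0 < q < p)%N ->
  rank_shift M L -> stable_block q M -> stable_block (p - q) L.
Proof.
move=> /andP[q0 qp] [d sh] Mq alpha; have [n Mn] := Mq alpha.
have := Mn 0%N isT; rewrite pi_rank0 !subn0 => dimM.
have := sh alpha 0%N isT; rewrite pi_rank0 subn0 pi_rank_ge // add0n => dimL.
have lt_nd : (n < d)%N.
  by rewrite -(ltn_pmul2l p_gt0) -dimL dimM mulnC; lia.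
exists (d - n.+1)%N => j le_jp; have := sh alpha j le_jp.
rewrite Mn ?leq_subr // dimM subKn //.
move: (pi_rank _ _ _) => r E.
have [c dE] : exists c, d = (n + c.+1)%N by exists (d - n.+1)%N; lia.
rewrite dE (_ : n + c.+1 - n.+1 = c)%N; last by lia.
have [a pE] : exists a, p = (j + a)%N by exists (p - j)%N; lia.
rewrite dE (_ : p - j = a)%N in E; last by lia.
rewrite (_ : p - j = a)%N; last by lia.
have e1 : (n * p = n * j + n * a)%N by rewrite -mulnDr -pE.
have e2 : (a * (n + c.+1) = n * a + c * a + a)%N.
  by rewrite mulnDr mulnS (mulnC a n) (mulnC a c); lia.
rewrite e1 e2 in E; lia.
Qed.
End Ranks.

Section Types.
Variables (k : fieldType) (p : nat) (G : finGroupScheme k).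
Hypothesis p_gt0 : (0 < p)%N.
Local Notation kG := (group_algebra G).
Implicit Types (M N L P : fdmod kG) (alpha : pi_point p G).

Lemma stable_block_iso q M N : mod_iso M N ->
  stable_block p q M -> stable_block p q N.
Proof.
move=> MN Mq alpha; have [n Mn] := Mq alpha.
by exists n => j le_jp; rewrite -(pi_rank_iso alpha j MN) Mn.
Qed.

Lemma constant_iso M N : mod_iso M N ->
  constant_jordan_type p M -> constant_jordan_type p N.
Proof.
move=> MN [a /(constant_rankP p_gt0) Ma]; exists a; apply/(constant_rankP p_gt0).
by move=> alpha j; rewrite -(pi_rank_iso alpha j MN).
Qed.

Lemma trivial_stable_block : stable_block p 1 (trivial_mod G).
Proof.
move=> alpha; exists 0%N => j _; rewrite mul0n.
case: j => [|j]; first exact: pi_rank0.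
have X0 : mact (pi_restriction alpha (trivial_mod G)) (tvar _ p) = 0.
  set X := mact _ _; have : X ^+ p = 0 := mact_nilp p_gt0 _.
  have XE i : (X ^+ i) 0 0 = X 0 0 ^+ i.
    elim: i => [|i IH]; first by rewrite mxE.
    by rewrite mxXS mxE big_ord1 IH -exprS.
  move=> /matrixP/(_ 0 0); rewrite XE mxE => /eqP.
  rewrite expf_eq0 => /andP[_ /eqP X00].
  by apply/matrixP => a b; rewrite (ord1 a) (ord1 b) X00 mxE.
by rewrite /pi_rank X0 mxXS mul0mx mxrank0; lia.
Qed.

Lemma projective_type P : projective P ->
  constant_jordan_type p P /\
  ((p %| mdim P)%N -> has_constant_jordan_type P (jt p p *+ (mdim P %/ p)%N)).
Proof.
case/projective_casimir => sigma cas.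
have rkP alpha j : pi_rank alpha P j = ((p - j) * (mdim P %/ p))%N.
  have [le_jp|lt_pj] := leqP j p; first exact: (casimir_rank p_gt0 alpha cas le_jp).2.
  by rewrite (eqP (ltnW lt_pj : p - j == 0)%N) mul0n pi_rank_ge // ltnW.
split=> [|_]; first exact: constant_rank rkP.
apply/(constant_rankP p_gt0) => alpha j.
by rewrite rkP jt_rankMn ?p_gt0 ?leqnn // mulnC.
Qed.

(** If p does not divide dim P, the integral attached to P has nonzero
    augmentation. *)
Lemma dvd_dim_projective P : p \in [pchar k] -> projective P ->
  ~ semisimple kG -> (p %| mdim P)%N.
Proof.
move=> chark /projective_casimir[sigma cas] nss.
rewrite (dvdn_pcharf chark); apply/negP => dimP; apply: nss.
have L1 : ev (integral sigma) 1 != 0 by rewrite (ev_integral1 cas); apply/negP.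
exact: maschke (integralP cas) L1.
Qed.
End Types.

Theorem proposition2p8 (k : fieldType) (p : nat) (G : finGroupScheme k)
    (charkp : p \in [pchar k]) :
  [/\ (* (1) *)
      constant_jordan_type p (trivial_mod G),
      (* (2) *)
      (forall P : fdmod (group_algebra G), projective P ->
         constant_jordan_type p P
         /\ (~ semisimple (group_algebra G) ->
             (p %| mdim P)%N
             /\ has_constant_jordan_type P (jt p p *+ (mdim P %/ p)%N))),
      (* (3) *)
      (forall (i : int) (N : fdmod (group_algebra G)),
         is_Heller_shift i (trivial_mod G) N ->
         (~~ odd `|i|%N ->
            exists n : nat, has_constant_jordan_type N (jt p p *+ n + jt p 1))
         /\ (odd `|i|%N ->
            exists m : nat,
              has_constant_jordan_type N (jt p p *+ m + jt p p.-1))),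
      (* (4) *)
      (forall (M N : fdmod (group_algebra G)) (i : int),
         constant_jordan_type p M -> is_Heller_shift i M N ->
         constant_jordan_type p N)
    & (* (5) *)
      (forall M M' : fdmod (group_algebra G),
         constant_jordan_type p M -> constant_jordan_type p M' ->
         constant_jordan_type p (dsum M M'))].
Proof.
have p_prime := pcharf_prime charkp; have p_gt1 := prime_gt1 p_prime.
have p_gt0 := prime_gt0 p_prime.
have triv := @trivial_stable_block k p G p_gt0.
split.
- have [|n jn] := stable_block_type p_gt0 _ triv; first by rewrite p_gt0.
  by exists (jt p p *+ n + jt p 1).
- move=> P projP; have [cP tP] := projective_type p_gt0 projP.
  split=> // nss; have dvdP := dvd_dim_projective charkp projP nss.
  by split=> //; apply: tP.
- move=> i N iN.
  have shift : stable_block p (if odd `|i|%N then p.-1 else 1) N.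
    apply: (Heller_ind p_gt0
      (Q := fun n L => stable_block p (if odd n then p.-1 else 1) L)) iN => //.
    + by move=> n L L'; apply: stable_block_iso.
    + move=> n L L' LL' Ln.
      rewrite (_ : (if odd n.+1 then _ else _) = p - (if odd n then p.-1 else 1))%N.
        by apply: stable_block_shift Ln => //; case: (odd n); lia.
      by rewrite /=; case: (odd n) => /=; lia.
  by split=> parity; rewrite ?parity ?(negPf parity) in shift;
     apply: (stable_block_type p_gt0 _ shift); lia.
- move=> M N i cM iN.
  apply: (Heller_ind p_gt0
    (Q := fun (_ : nat) L => constant_jordan_type p L)) iN => //.
  + by move=> n L L'; apply: constant_iso.
  + by move=> n L L'; apply: constant_shift.
- move=> M M' [a /(constant_rankP p_gt0) Ma] [b /(constant_rankP p_gt0) Mb].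
  apply: (constant_rank p_gt0 (r := fun j => _ + _)%N) => alpha j.
  by rewrite pi_rank_dsum Ma Mb.
Qed.
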